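(* Let $R$ be an associative ring with $1$ and let $T$ be the complete first-order theory of the free left $R$-modules of infinite rank. The following are equivalent. (a) $R$ is left perfect. (b) Every countably generated flat model of $T$ is projective. (c) For every Bass module $B$ over $R$, the model $R^{(\omega)}\oplus B$ of $T$ is projective.
   Context: Modules are unitary left $R$-modules. $T$ is a theory in the first-order language of left $R$-modules; it is complete because all free left $R$-modules of infinite rank are elementarily equivalent. $R^{(\omega)}$ is the free left $R$-module of countably infinite rank. $R$ is left perfect if every flat left $R$-module is projective. Bass modules: let $R\supseteq a_1R\supseteq a_2R\supseteq a_3R\supseteq\cdots$ be a descending chain of principal right ideals. Set $a_0=1$ and choose $b_1,b_2,\ldots\in R$ with $a_{n+1}=a_nb_{n+1}$ for all $n\ge 0$ (so $a_n=b_1b_2\cdots b_n$ for $n>0$). Let $A_i={}_RR$ for $i\ge 0$ and let $f_i:A_i\to A_{i+1}$ be right multiplication by $b_{i+1}$. The direct limit $B$ of $A_0\to A_1\to A_2\to\cdots$ is called the Bass module corresponding to this chain. *)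

(* Defs.v *)
From HB Require Import structures.
From mathcomp Require Import all_boot all_algebra.
From mathcomp Require Import boolp classical_sets functions cardinality fsbigop.

Set Implicit Arguments.
Unset Strict Implicit.
Unset Printing Implicit Defensive.

Import GRing.Theory.
Local Open Scope classical_set_scope.
Local Open Scope ring_scope.

(* Conventions: a ring is a [pzRingType] (associative, with 1, possibly zero);
   a left R-module is an [lmodType R] and a right R-module an [lmodType R^c],
   whose scaling [(a : R^c) *: x] is the right action of [a] on [x].  In the
   presence of the choice operator of boolp, the choice structures carried by
   modules and index types are no restriction. *)

Section FreeModule.
Variables (R : pzRingType) (I : choiceType).

Definition fin_supp : {pred I -> R^o} :=
  fun f => `[< finite_set [set i | f i != 0] >].

Lemma fin_supp_submod : submod_closed fin_supp.
Proof.
split=> [|a f g]; rewrite !unfold_in /=.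
  by apply/asboolP; apply: (sub_finite_set _ (@finite_set0 I)) => i /=; rewrite eqxx.
move=> /asboolP ff /asboolP fg; apply/asboolP.
apply: (@sub_finite_set _ _ ([set i | f i != 0] `|` [set i | g i != 0])).
  move=> i /= H.
  have [f0|] := eqVneq (f i) 0; last by left.
  right; apply: contraNneq H => g0.
  have -> : (a *: f + g) i = a *: f i + g i by [].
  by rewrite f0 g0 scaler0 addr0.
by rewrite finite_setU.
Qed.

HB.instance Definition _ :=
  GRing.isSubmodClosed.Build R (I -> R^o) fin_supp fin_supp_submod.

Record freeMod := FreeMod { coefs : I -> R^o ; _ : coefs \in fin_supp }.

HB.instance Definition _ := [isSub for coefs].
HB.instance Definition _ := [Choice of freeMod by <:].
HB.instance Definition _ := [SubChoice_isSubLmodule of freeMod by <:].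

Definition fcoef (v : freeMod) : I -> R := coefs v.
Coercion fcoef : freeMod >-> Funclass.

Lemma delta_fin_supp (i : I) : (fun j => (i == j)%:R : R^o) \in fin_supp.
Proof.
rewrite unfold_in; apply/asboolP.
apply: (sub_finite_set _ (finite_set1 i)) => j /=.
by case: (eqVneq i j) => [->//|_]; rewrite eqxx.
Qed.

Definition delta (i : I) : freeMod := FreeMod (delta_fin_supp i).

Lemma freeMod_finite (v : freeMod) : finite_set [set i | v i != 0].
Proof. by case: v => f /=; rewrite unfold_in => /asboolP. Qed.

Lemma fcoefZ (a : R) (v : freeMod) i : (a *: v) i = a * v i.
Proof. by []. Qed.

Lemma fcoefD (u v : freeMod) i : (u + v) i = u i + v i.
Proof. by []. Qed.

Section Lift.
Variables (V : lmodType R) (g : I -> V).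

Definition free_lift (v : freeMod) : V := \sum_(i \in [set: I]) v i *: g i.

Lemma free_lift_seq (s : seq I) (v : freeMod) :
  uniq s -> (forall i, v i != 0 -> i \in s) ->
  free_lift v = \sum_(i <- s) v i *: g i.
Proof.
move=> us sv; rewrite fsbig_seq // /free_lift.
symmetry; apply: fsbig_widen => // i [_ /= nis].
by apply/eqP; apply: contraT => H; case: nis; apply: sv; apply: contraNneq H => ->; rewrite scale0r.
Qed.

Lemma free_lift_linear : linear free_lift.
Proof.
move=> a u v.
have : finite_set ([set i | u i != 0] `|` [set i | v i != 0]).
  by rewrite finite_setU; split; apply: freeMod_finite.
move=> /finite_seqP [s hs].
have su i : u i != 0 -> i \in undup s.
  by move=> ui; rewrite mem_undup; have : [set` s] i by rewrite -hs; left.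
have sv i : v i != 0 -> i \in undup s.
  by move=> vi; rewrite mem_undup; have : [set` s] i by rewrite -hs; right.
rewrite !(@free_lift_seq (undup s)) ?undup_uniq //; last first.
  move=> i; rewrite fcoefD fcoefZ => H.
  have [u0|/su//] := eqVneq (u i) 0.
  by apply: sv; apply: contraNneq H => ->; rewrite u0 mulr0 addr0.
rewrite scaler_sumr -big_split; apply: eq_bigr => i _ /=.
by rewrite scalerDl scalerA.
Qed.

HB.instance Definition _ :=
  GRing.isLinear.Build R freeMod V *:%R free_lift free_lift_linear.

Lemma free_lift_delta i : free_lift (delta i) = g i.
Proof.
rewrite (@free_lift_seq [:: i]) //.
  by rewrite big_seq1 /= eqxx scale1r.
move=> j; rewrite /fcoef /= mem_seq1.
by case: (eqVneq i j) => // _; rewrite eqxx.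
Qed.

End Lift.

Lemma freeMod_gen (v : freeMod) : v = free_lift delta v.
Proof.
have /finite_seqP [s hs] := freeMod_finite v.
have sv i : v i != 0 -> i \in undup s.
  by move=> vi; rewrite mem_undup; have : [set` s] i by rewrite -hs.
rewrite (@free_lift_seq _ _ (undup s)) ?undup_uniq //.
apply: val_inj; apply: funext => j /=.
have E (t : seq I) : fcoef (\sum_(i <- t) v i *: delta i) j
    = \sum_(i <- t) v i * (i == j)%:R.
  by elim: t => [|i t IH]; rewrite ?big_nil // !big_cons fcoefD IH fcoefZ.
transitivity (fcoef (\sum_(i <- undup s) v i *: delta i) j); last by [].
rewrite E -[LHS]/(v j).
have [jin|jnin] := boolP (j \in undup s).
  rewrite (bigD1_seq j) ?undup_uniq //= eqxx mulr1 big1 ?addr0 // => i /negPf ->.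
  by rewrite mulr0.
rewrite big_seq big1 => [|i iin].
  by apply/eqP; apply: contraNT jnin => /sv.
by case: eqVneq => [ij|]; rewrite ?mulr0 //; rewrite ij (negPf jnin) in iin.
Qed.

Lemma freeMod_ext (V : lmodType R) (h k : {linear freeMod -> V}) :
  (forall i, h (delta i) = k (delta i)) -> h =1 k.
Proof.
move=> hk v; rewrite (freeMod_gen v).
have /finite_seqP [s hs] := freeMod_finite v.
have sv i : v i != 0 -> i \in undup s.
  by move=> vi; rewrite mem_undup; have : [set` s] i by rewrite -hs.
rewrite (@free_lift_seq _ _ (undup s)) ?undup_uniq // !linear_sum.
by apply: eq_bigr => i _; rewrite !linearZ_LR hk.
Qed.

End FreeModule.

Section QuotientModule.
Variables (R : pzRingType) (M : lmodType R) (S : set M).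

Definition submodule (P : set M) : Prop :=
  [/\ P 0, (forall x y, P x -> P y -> P (x + y))
    & (forall a x, P x -> P (a *: x))].

Definition gen_submod : {pred M} :=
  fun x => `[< forall P, submodule P -> S `<=` P -> P x >].

Lemma gen_submod_closed : submod_closed gen_submod.
Proof.
split=> [|a x y]; rewrite !unfold_in.
  by apply/asboolP => P [].
move=> /asboolP hx /asboolP hy; apply/asboolP => P sP SP.
by case: (sP) => _ hD hZ; apply: hD; [apply: hZ; apply: hx | apply: hy].
Qed.

HB.instance Definition _ := GRing.isSubmodClosed.Build R M gen_submod gen_submod_closed.

Lemma sub_gen_submod x : S x -> x \in gen_submod.
Proof. by move=> Sx; rewrite unfold_in; apply/asboolP => P _; apply. Qed.

Definition quotMod := Quotient.quot gen_submod.
HB.instance Definition _ := GRing.Zmodule.on quotMod.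
HB.instance Definition _ := Quotient.on quotMod.

Definition proj (x : M) : quotMod := (\pi_quotMod x)%qT.

Lemma projE x y : (proj x == proj y) = (x - y \in gen_submod).
Proof. by rewrite /proj piE Quotient.equivE. Qed.

Lemma proj_repr (q : quotMod) : proj (repr q) = q.
Proof. exact: reprK. Qed.

Lemma projD : {morph proj : x y / x + y}.
Proof. by move=> x y; rewrite /proj; apply: raddfD. Qed.

Definition quot_scale (a : R) (q : quotMod) : quotMod := proj (a *: repr q).

Lemma proj_scale a x : quot_scale a (proj x) = proj (a *: x).
Proof.
apply/eqP; rewrite projE -scalerBr; apply: rpredZ.
by rewrite -projE proj_repr.
Qed.

Lemma quot_scaleA a b q : quot_scale a (quot_scale b q) = quot_scale (a * b) q.
Proof. by rewrite -(proj_repr q) !proj_scale scalerA. Qed.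
Lemma quot_scale1 : left_id 1 quot_scale.
Proof. by move=> q; rewrite -{1}(proj_repr q) proj_scale scale1r proj_repr. Qed.
Lemma quot_scaleDr : right_distributive quot_scale +%R.
Proof.
move=> a p q; rewrite -(proj_repr p) -(proj_repr q) -projD !proj_scale.
by rewrite -projD scalerDr.
Qed.
Lemma quot_scaleDl q : {morph quot_scale^~ q : a b / a + b}.
Proof. by move=> a b; rewrite -(proj_repr q) !proj_scale -projD scalerDl. Qed.

HB.instance Definition _ := GRing.Zmodule_isLmodule.Build R quotMod
  quot_scaleA quot_scale1 quot_scaleDr quot_scaleDl.

Lemma proj_linear : linear proj.
Proof. by move=> a x y; rewrite projD -proj_scale. Qed.

HB.instance Definition _ :=
  GRing.isLinear.Build R M quotMod *:%R proj proj_linear.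

Lemma proj_rel x : S x -> proj x = 0.
Proof.
by move=> Sx; rewrite -(raddf0 proj); apply/eqP; rewrite projE subr0 sub_gen_submod.
Qed.

Section Lift.
Variables (V : lmodType R) (h : {linear M -> V}).

(* meaningful when [h] vanishes on [S] *)
Definition quot_lift (q : quotMod) : V := h (repr q).

Hypothesis hS : forall x, S x -> h x = 0.

Lemma gen_submod_ker x : x \in gen_submod -> h x = 0.
Proof.
rewrite unfold_in => /asboolP sx; apply: (sx [set x | h x = 0]) => //.
split=> [|x1 y hx hy|a x1 hx] /=.
- by rewrite raddf0.
- by rewrite linearD hx hy addr0.
- by rewrite linearZ_LR hx scaler0.
Qed.

Lemma quot_lift_proj x : quot_lift (proj x) = h x.
Proof.
apply/eqP; rewrite -subr_eq0 /quot_lift -raddfB; apply/eqP; apply: gen_submod_ker.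
by rewrite -projE proj_repr.
Qed.

Lemma quot_lift_linear : linear quot_lift.
Proof.
move=> a p q; rewrite -(proj_repr p) -(proj_repr q) -linearP.
by rewrite !quot_lift_proj linearP.
Qed.

End Lift.
End QuotientModule.

Section Tensor.
Variables (R : pzRingType) (M : lmodType R).

Section Def.
Variable N : lmodType R^c.

Definition tensor_rel : set (freeMod int (N * M)%type) := [set r |
  [\/ exists x x' y, r = delta _ (x + x', y) - delta _ (x, y) - delta _ (x', y),
      exists x y y', r = delta _ (x, y + y') - delta _ (x, y) - delta _ (x, y')
    | exists x (a : R) y, r = delta _ ((a : R^c) *: x, y) - delta _ (x, a *: y)]].

(* abelian groups are treated as modules over [int] *)
Definition tensor := quotMod tensor_rel.
HB.instance Definition _ := GRing.Lmodule.on tensor.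

Definition pure (x : N) (y : M) : tensor := proj tensor_rel (delta _ (x, y)).

Lemma pureDl x x' y : pure (x + x') y = pure x y + pure x' y.
Proof.
apply/eqP; rewrite -subr_eq0 opprD addrA -!raddfB; apply/eqP/proj_rel.
by apply: Or31; exists x, x', y.
Qed.

Lemma pureDr x y y' : pure x (y + y') = pure x y + pure x y'.
Proof.
apply/eqP; rewrite -subr_eq0 opprD addrA -!raddfB; apply/eqP/proj_rel.
by apply: Or32; exists x, y, y'.
Qed.

Lemma pureA x (a : R) y : pure ((a : R^c) *: x) y = pure x (a *: y).
Proof.
apply/eqP; rewrite -subr_eq0 -raddfB; apply/eqP/proj_rel.
by apply: Or33; exists x, a, y.
Qed.

Section UniversalProperty.
Variables (V : lmodType int) (g : N -> M -> V).
Hypothesis gDl : forall x x' y, g (x + x') y = g x y + g x' y.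
Hypothesis gDr : forall x y y', g x (y + y') = g x y + g x y'.
Hypothesis gA : forall x (a : R) y, g ((a : R^c) *: x) y = g x (a *: y).

Definition tensor_lift : tensor -> V :=
  quot_lift (S := tensor_rel) (free_lift (fun p => g p.1 p.2)).

Lemma tensor_lift_rel r :
  tensor_rel r -> free_lift (fun p => g p.1 p.2) r = 0.
Proof.
case=> [[x [x' [y ->]]]|[x [y [y' ->]]]|[x [a [y ->]]]];
  rewrite !linearB /= !free_lift_delta /=.
- by rewrite gDl addrAC addrK subrr.
- by rewrite gDr addrAC addrK subrr.
- by rewrite gA subrr.
Qed.

Lemma tensor_lift_linear : linear tensor_lift.
Proof. exact: quot_lift_linear tensor_lift_rel. Qed.

Lemma tensor_lift_pure x y : tensor_lift (pure x y) = g x y.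
Proof.
rewrite /tensor_lift /pure quot_lift_proj; last exact: tensor_lift_rel.
by rewrite /= free_lift_delta.
Qed.

End UniversalProperty.
End Def.

Definition tensor_map (N N' : lmodType R^c) (f : {linear N -> N'}) :
  tensor N -> tensor N' := tensor_lift (fun x y => pure (f x) y).

Lemma tensor_map_linear (N N' : lmodType R^c) (f : {linear N -> N'}) :
  linear (tensor_map f).
Proof.
apply: tensor_lift_linear => [x x' y|x y y'|x a y].
- by rewrite raddfD pureDl.
- exact: pureDr.
- by rewrite linearZ pureA.
Qed.

Lemma tensor_map_pure (N N' : lmodType R^c) (f : {linear N -> N'}) x y :
  tensor_map f (pure x y) = pure (f x) y.
Proof.
apply: tensor_lift_pure => [x1 x' y1|x1 y1 y'|x1 a y1].
- by rewrite raddfD pureDl.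
- exact: pureDr.
- by rewrite linearZ pureA.
Qed.

End Tensor.

Definition flat (R : pzRingType) (M : lmodType R) : Prop :=
  forall (N N' : lmodType R^c) (f : {linear N -> N'}),
    injective f -> injective (tensor_map (M := M) f).

Definition projective (R : pzRingType) (P : lmodType R) : Prop :=
  forall (N N' : lmodType R) (g : {linear N -> N'}) (f : {linear P -> N'}),
    (forall y, exists x, g x = y) ->
    exists h : {linear P -> N}, forall p, g (h p) = f p.

Definition countably_generated (R : pzRingType) (M : lmodType R) : Prop :=
  exists e : nat -> M, forall x : M,
    exists (n : nat) (c : 'I_n -> R), x = \sum_(i < n) c i *: e i.

Definition left_perfect (R : pzRingType) : Prop :=
  forall M : lmodType R, flat M -> projective M.

Inductive mterm (R : Type) : Type :=
| MVar of nat
| MZero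
| MAdd of mterm R & mterm R
| MOpp of mterm R
| MScale of R & mterm R.

(* the remaining connectives and the universal quantifier are definable, the
   semantics being classical *)
Inductive mform (R : Type) : Type :=
| MEq of mterm R & mterm R
| MNot of mform R
| MAnd of mform R & mform R
| MEx of nat & mform R.

Arguments MVar {R} _.
Arguments MZero {R}.

Fixpoint mterm_vars (R : Type) (t : mterm R) : seq nat :=
  match t with
  | MVar n => [:: n]
  | MZero => [::]
  | MAdd t1 t2 => mterm_vars t1 ++ mterm_vars t2
  | MOpp t1 => mterm_vars t1
  | MScale _ t1 => mterm_vars t1
  end.

Fixpoint free_vars (R : Type) (p : mform R) : seq nat :=
  match p with
  | MEq t1 t2 => mterm_vars t1 ++ mterm_vars t2
  | MNot q => free_vars q
  | MAnd q1 q2 => free_vars q1 ++ free_vars q2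
  | MEx n q => [seq m <- free_vars q | m != n]
  end.

Definition sentence (R : Type) (p : mform R) : Prop := free_vars p = [::].

Section Semantics.
Variables (R : pzRingType) (M : lmodType R).

Fixpoint meval (e : nat -> M) (t : mterm R) : M :=
  match t with
  | MVar n => e n
  | MZero => 0
  | MAdd t1 t2 => meval e t1 + meval e t2
  | MOpp t1 => - meval e t1
  | MScale a t1 => a *: meval e t1
  end.

Definition env_set (e : nat -> M) (n : nat) (x : M) : nat -> M :=
  fun m => if m == n then x else e m.

Fixpoint mholds (e : nat -> M) (p : mform R) : Prop :=
  match p with
  | MEq t1 t2 => meval e t1 = meval e t2
  | MNot q => ~ mholds e q
  | MAnd q1 q2 => mholds e q1 /\ mholds e q2
  | MEx n q => exists x : M, mholds (env_set e n x) q
  end.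

(* for a sentence the value does not depend on the assignment *)
Definition satisfies (p : mform R) : Prop := forall e, mholds e p.

Definition free_of_infinite_rank : Prop :=
  exists (I : choiceType) (f : {linear freeMod R I -> M}),
    infinite_set [set: I] /\ bijective f.

End Semantics.

Definition free_theory (R : pzRingType) : set (mform R) :=
  [set p | sentence p /\
    forall F : lmodType R, free_of_infinite_rank F -> satisfies F p].

Arguments free_theory R _ : clear implicits.

(* The module axioms hold in every [lmodType R], so that the models of the
   theory are the left R-modules satisfying it. *)
Definition model_of_free_theory (R : pzRingType) (M : lmodType R) : Prop :=
  forall p, free_theory R p -> satisfies M p.

(* [a] gives the chain, whose inclusions [a n.+1 R <= a n R] are witnessed by
   [b]; the value [b 0] is irrelevant *)
Definition bass_chain (R : pzRingType) (a b : nat -> R) : Prop :=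
  a 0%N = 1 /\ forall n, a n.+1 = a n * b n.+1.

Section Bass.
Variables (R : pzRingType) (b : nat -> R).

Definition bass_map (i : nat) (x : R) : R := x * b i.+1.

(* The direct limit of [A_0 -> A_1 -> ...] with all [A_i] equal to R is the
   quotient of the direct sum R^(nat) of the [A_i] identifying [x] in [A_i]
   with its image in [A_(i+1)]; see [bass_in_compat] and [bass_universal]. *)
Definition bass_rel : set (freeMod R nat) :=
  [set r | exists (i : nat) (x : R), r = x *: delta R i - bass_map i x *: delta R i.+1].

Definition bassMod := quotMod bass_rel.
HB.instance Definition _ := GRing.Lmodule.on bassMod.

Definition bass_in (i : nat) (x : R) : bassMod :=
  proj bass_rel (x *: delta R i).

Lemma bass_in_linear i : linear (bass_in i : R^o -> bassMod).
Proof. by move=> a x y; rewrite /bass_in scalerDl -scalerA linearP. Qed.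

HB.instance Definition _ i :=
  GRing.isLinear.Build R R^o bassMod *:%R (bass_in i) (bass_in_linear i).

Lemma bass_in_compat i x : bass_in i.+1 (bass_map i x) = bass_in i x.
Proof.
symmetry; apply/eqP; rewrite -subr_eq0 /bass_in -linearB; apply/eqP/proj_rel.
by exists i, x.
Qed.

Lemma bass_universal (V : lmodType R) (g : forall i, {linear R^o -> V}) :
  (forall i x, g i.+1 (bass_map i x) = g i x) ->
  exists! h : bassMod -> V, linear h /\ forall i x, h (bass_in i x) = g i x.
Proof.
move=> gc; pose g0 (i : nat) := g i (1 : R^o).
have g0E i (x : R) : x *: g0 i = g i x.
  by rewrite /g0 -linearZ; congr (g i _); exact: mulr1.
have hS r : bass_rel r -> free_lift g0 r = 0.
  case=> i [x ->]; rewrite linearB /= !linearZ_LR /= !free_lift_delta.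
  by rewrite scalerN !g0E gc subrr.
exists (quot_lift (free_lift g0)); split.
  split=> [|i x]; first exact: quot_lift_linear.
  by rewrite /bass_in quot_lift_proj // linearZ /= free_lift_delta g0E.
move=> h [hl hg]; apply: funext => q; rewrite -(proj_repr q) quot_lift_proj //.
pose hh : {linear bassMod -> V} :=
  HB.pack h (GRing.isLinear.Build R bassMod V *:%R h hl).
pose k : {linear freeMod R nat -> V} := hh \o proj bass_rel.
have E : free_lift g0 =1 k.
  apply: freeMod_ext => i /=.
  by rewrite free_lift_delta -(scale1r (delta R i)) -/(bass_in i 1) hg.
exact: (E (repr q)).
Qed.

End Bass.

(* Main.v *)
(* That R^(omega) + B is a model of T is Baur-Monk elimination of quantifiers:
   a pp-index equal to 1 in R is 1 in every direct limit of free modules, and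
   otherwise it is infinite in any module with R^(omega) as a direct summand.

   (b) => (c): R^(omega) + B is countably generated and, being a direct limit
   of free modules, flat.

   (c) => (a): if s is a section of R^(omega) -> B and z_n is the image of
   1 in A_n, then s(z_0) = a_n s(z_n); comparing z_0 with the image of s(z_0)
   gives a_m in a_n R for some m and all n.  Hence principal right ideals
   satisfy the minimum condition.  Let J be the Jacobson radical.  The minimum
   condition yields JM = M => M = 0 (Nakayama), and enough idempotents e for
   which R e / J e is simple.  For a flat module M, a maximal family of pairs
   (e, x) with x in e M that is independent modulo JM defines a map
   P = (+) R e -> M, onto by Nakayama, with kernel K inside JP; flatness gives
   K = JK, so K = 0 and M is projective. *)
Require Import Defs.
From HB Require Import structures.
From mathcomp Require Import all_boot all_algebra.
From mathcomp Require Import boolp classical_sets functions cardinality fsbigop.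

Set Implicit Arguments.
Unset Strict Implicit.
Unset Printing Implicit Defensive.

Import GRing.Theory.
Local Open Scope classical_set_scope.
Local Open Scope ring_scope.

(** * Elimination of quantifiers down to positive primitive formulas *)

Section FreeOnNat.
Variable R : pzRingType.
Notation F := (freeMod R nat).

Lemma freeMod_bound (v : F) : exists m : nat, forall j, (m <= j)%N -> v j = 0.
Proof.
have /finite_seqP [s hs] := freeMod_finite v.
exists (\max_(i <- s) i.+1) => j; rewrite leqNgt => hj.
apply/eqP; apply: contraNT hj => vj.
have js : j \in s by have : [set` s] j by rewrite -hs.
exact: (@bigmax_sup_seq _ s j xpredT).
Qed.

Lemma fcoef_delta (i j : nat) : delta R i j = (i == j)%:R :> R.
Proof. by []. Qed.

Lemma free_lift_nat (V : lmodType R) (g : nat -> V) (v : F) m :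
  (forall j, (m <= j)%N -> v j = 0) -> free_lift g v = \sum_(i < m) v i *: g i.
Proof.
move=> hm; rewrite (@free_lift_seq _ _ _ _ (iota 0 m)) ?iota_uniq //.
  by rewrite -(big_mkord xpredT (fun i => v i *: g i)) /index_iota subn0.
by move=> i vi; rewrite mem_iota /= add0n ltnNge; apply: contraNN vi => /hm ->.
Qed.

Lemma freeMod_nat_sum (v : F) m :
  (forall j, (m <= j)%N -> v j = 0) -> v = \sum_(i < m) v i *: delta R (i : nat).
Proof. by move=> hm; rewrite [LHS]freeMod_gen (free_lift_nat _ hm). Qed.

Definition fcoord (i : nat) (v : F) : R^o := v i.

Lemma fcoord_linear i : linear (fcoord i). Proof. by []. Qed.
HB.instance Definition _ i :=
  GRing.isLinear.Build R F R^o *:%R (fcoord i) (fcoord_linear i).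

(** The homomorphism of left modules that sends 1 to [x]; for [V = R^o] it is right multiplication
    by [x]. *)
Definition cscale (V : lmodType R) (x : V) (a : R^o) : V := (a : R) *: x.
Lemma cscale_linear (V : lmodType R) (x : V) : linear (cscale x).
Proof. by move=> a b c; rewrite /cscale scalerDl scalerA. Qed.
HB.instance Definition _ (V : lmodType R) (x : V) :=
  GRing.isLinear.Build R R^o V *:%R (cscale x) (cscale_linear x).

End FreeOnNat.

Section PositivePrimitive.
Variable R : pzRingType.

Fixpoint is_pp (p : mform R) : bool :=
  match p with
  | MEq _ _ => true
  | MNot _ => false
  | MAnd q1 q2 => is_pp q1 && is_pp q2
  | MEx _ q => is_pp q
  end.

Lemma meval_hom (M N : lmodType R) (h : {linear M -> N}) (e : nat -> M) t :
  meval (h \o e) t = h (meval e t).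
Proof.
elim: t => [n||t1 IH1 t2 IH2|t IH|a t IH] //=; rewrite ?raddf0 //.
- by rewrite IH1 IH2 raddfD.
- by rewrite IH raddfN.
- by rewrite IH linearZ.
Qed.

Lemma env_set_comp (M N : lmodType R) (h : M -> N) (e : nat -> M) n x :
  env_set (h \o e) n (h x) = h \o env_set e n x.
Proof. by apply: funext => m; rewrite /env_set /=; case: eqP. Qed.

Lemma pp_hom (M N : lmodType R) (h : {linear M -> N}) (e : nat -> M) p :
  is_pp p -> mholds e p -> mholds (h \o e) p.
Proof.
elim: p e => [t1 t2|p IH|p IHp q IHq|n p IH] e //=.
- by rewrite !meval_hom => _ ->.
- by move=> /andP [pp pq] [hp hq]; split; [exact: IHp|exact: IHq].
- move=> pp [x hx]; exists (h x).
  by rewrite env_set_comp; exact: IH.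
Qed.

Lemma pp_pair (M N : lmodType R) (e : nat -> (M * N)%type) p :
  is_pp p -> mholds (fst \o e) p -> mholds (snd \o e) p -> mholds e p.
Proof.
elim: p e => [t1 t2|p IH|p IHp q IHq|n p IH] e //=.
- move=> _; rewrite !meval_hom => h1 h2.
  by rewrite [LHS]surjective_pairing h1 h2 -surjective_pairing.
- by move=> /andP [pp pq] [hp hq] [hp' hq']; split; [exact: IHp|exact: IHq].
- move=> pp [x hx] [y hy]; exists (x, y); apply: IH => //.
  + by rewrite -env_set_comp.
  + by rewrite -env_set_comp.
Qed.

Section Module.
Variable M : lmodType R.

Lemma pp0 p : is_pp p -> mholds (fun=> 0 : M) p.
Proof.
elim: p => [t1 t2|p IH|p IHp q IHq|n p IH] //=.
- have E t : meval (fun=> 0 : M) t = 0.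
    elim: t => [n||t IHt t' IHt'|t IHt|a t IHt] //=; rewrite ?IHt ?IHt' ?addr0 ?oppr0 ?scaler0 //.
  by rewrite !E.
- by move=> /andP [pp pq]; split; [exact: IHp|exact: IHq].
- move=> /IH hp; exists 0.
  by rewrite /env_set (_ : (fun=> _) = (fun=> 0)) //; apply: funext => m; case: eqP.
Qed.

Definition subp (z : (M * M)%type) : M := z.1 - z.2.
Lemma subp_linear : linear subp.
Proof. by move=> a x y; rewrite /subp /= scalerBr opprD addrACA. Qed.
HB.instance Definition _ :=
  GRing.isLinear.Build R (M * M)%type M *:%R subp subp_linear.

(** Positive primitive formulas pass to products and along homomorphisms, in particular along the
    subtraction map from [M * M] to [M]. *)
Lemma ppB (e e' : nat -> M) p :
  is_pp p -> mholds e p -> mholds e' p -> mholds (fun n => e n - e' n) p.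
Proof.
move=> pp hp hp'; apply: (@pp_hom _ _ subp (fun n => (e n, e' n))) => //.
exact: pp_pair.
Qed.

(** For positive primitive [p] this is the pp-definable subgroup. With parameters [e] in place of 0,
    the solutions form a coset of it or the empty set. *)
Definition section p (n : nat) : set M := fun x => mholds (env_set (fun=> 0) n x) p.

Lemma section0 p n : is_pp p -> section p n 0.
Proof.
move=> pp; rewrite /section /env_set (_ : (fun=> _) = (fun=> 0)); first exact: pp0.
by apply: funext => m; case: eqP.
Qed.

Lemma env_setB (e e' : nat -> M) n x y :
  env_set (fun m => e m - e' m) n (x - y) = fun m => env_set e n x m - env_set e' n y m.
Proof. by apply: funext => m; rewrite /env_set; case: eqP. Qed.

Lemma sectionB p n x y :
  is_pp p -> section p n x -> section p n y -> section p n (x - y).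
Proof.
move=> pp hx hy; have := ppB pp hx hy; rewrite -env_setB /section.
by congr mholds; congr env_set; apply: funext => m; rewrite subrr.
Qed.

Lemma sectionD p n x y :
  is_pp p -> section p n x -> section p n y -> section p n (x + y).
Proof.
move=> pp hx hy; rewrite -(opprK y) -(sub0r y).
by do !apply: sectionB => //; exact: section0.
Qed.

Lemma section_sum p n (I : Type) (r : seq I) (f : I -> M) :
  is_pp p -> (forall i, section p n (f i)) -> section p n (\sum_(i <- r) f i).
Proof.
move=> pp hf; apply: big_ind => [|x y|i _]; [exact: section0|exact: sectionD|exact: hf].
Qed.

Lemma coset_diff p (e : nat -> M) n x y :
  is_pp p -> mholds (env_set e n x) p -> mholds (env_set e n y) p ->
  section p n (x - y).
Proof.
move=> pp hx hy; have := ppB pp hx hy; rewrite -env_setB /section.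
by congr mholds; congr env_set; apply: funext => m; rewrite subrr.
Qed.

Lemma coset_add p (e : nat -> M) n x y :
  is_pp p -> mholds (env_set e n x) p -> section p n y ->
  mholds (env_set e n (x + y)) p.
Proof.
move=> pp hx hy.
have hN : section p n (- y) by rewrite -sub0r; apply: sectionB => //; exact: section0.
have := ppB pp hx hN; rewrite -env_setB opprK.
by congr mholds; congr env_set; apply: funext => m; rewrite subr0.
Qed.

End Module.

Lemma section_hom (M N : lmodType R) (h : {linear M -> N}) p n x :
  is_pp p -> section p n x -> section p n (h x).
Proof.
move=> pp /(pp_hom h pp); rewrite /section -env_set_comp.
by congr mholds; congr env_set; apply: funext => m /=; rewrite raddf0.
Qed.

(* These conditions make every pp-index of [M] either 1, exactly when it is 1
   in [R], or infinite. *)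
Definition free_like (M : lmodType R) : Prop :=
  (exists (iota : {linear freeMod R nat -> M}) (pi : {linear M -> freeMod R nat}),
     cancel iota pi) /\
  forall p q n, is_pp p -> is_pp q ->
    (section p n : set R^o) `<=` section q n -> (section p n : set M) `<=` section q n.

(* A special case of Neumann's lemma on coset coverings.  The coordinates of the
   free retract not met by the finitely many elements involved leave room to
   avoid all cosets of infinite index at once. *)
Lemma coset_avoid (M : lmodType R) (e : nat -> M) n p (I : finType) (B : {set I})
    (q : I -> mform R) :
  free_like M -> is_pp p -> (forall i, is_pp (q i)) ->
  (exists x, mholds (env_set e n x) p) ->
  (forall i, i \in B -> (section p n : set R^o) `<=` section (q i) n ->
     ~ exists x, mholds (env_set e n x) p /\ mholds (env_set e n x) (q i)) ->
  exists x, mholds (env_set e n x) p /\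
    forall i, i \in B -> ~ mholds (env_set e n x) (q i).
Proof.
move=> [[iota [pi iotaK]] hM] pp pq [x0 hx0] hB.
have /choice [r hr] i : exists r : R^o, section p n r /\
    (~ (section p n : set R^o) `<=` section (q i) n -> ~ section (q i) n r).
  have [h|h] := pselect ((section p n : set R^o) `<=` section (q i) n).
    by exists 0; split=> //; exact: section0.
  by move/existsNP: (h) => [r /not_implyP [rp rq]]; exists r.
have /choice [y hy] i : exists y, (exists x, mholds (env_set e n x) (q i)) ->
    mholds (env_set e n y) (q i).
  have [[x hx]|h] := pselect (exists x, mholds (env_set e n x) (q i)); last by exists 0.
  by exists x.
have /choice [m hm] i := freeMod_bound (pi (x0 - y i)).
(* [N] lies beyond the supports of all [pi (x0 - y i)], and the [u i] occupy distinct coordinates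
   from [N] on. *)
pose N := (\max_i m i)%N.
pose u i : M := iota ((r i : R) *: delta R (N + enum_rank i)%N).
have hp : mholds (env_set e n (x0 + \sum_i u i)) p.
  apply: coset_add => //; apply: section_sum => // i.
  have -> : u i = (iota \o @cscale R (freeMod R nat) (delta R (N + enum_rank i)%N)) (r i) by [].
  by apply: section_hom => //; case: (hr i).
exists (x0 + \sum_i u i); split=> // i iB hq.
have [h|h] := pselect ((section p n : set R^o) `<=` section (q i) n).
  by apply: (hB i iB h); exists (x0 + \sum_i u i).
have [_ /(_ h)] := hr i; apply.
have hyi := hy i (ex_intro (fun x => mholds (env_set e n x) (q i)) _ hq).
pose J := (N + enum_rank i)%N.
suff <- : fcoord J (pi (x0 + \sum_i u i - y i)) = r i.
  apply: (section_hom (fcoord J) (pq i)); apply: (section_hom pi (pq i)).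
  exact: coset_diff (pq i) hq hyi.
transitivity (pi (x0 - y i) J + fcoord J (\sum_j pi (u j))).
  by rewrite [x0 + _ - _]addrAC raddfD; congr (_ + fcoord J _); rewrite raddf_sum.
rewrite hm ?add0r; last first.
  by apply: leq_trans (leq_addr _ _); exact: leq_bigmax.
rewrite raddf_sum (bigD1 i) //= big1 => [|j ji]; rewrite /fcoord /u iotaK fcoefZ fcoef_delta.
  by rewrite eqxx mulr1 addr0.
by rewrite eqn_add2l (inj_eq val_inj) (inj_eq enum_rank_inj) (negPf ji) mulr0.
Qed.

Definition pp_conj (I : finType) (p : I -> mform R) (A : {set I}) : mform R :=
  foldr (@MAnd R) (MEq MZero MZero) [seq p i | i <- enum A].

Lemma pp_conj_pp (I : finType) (p : I -> mform R) A :
  (forall i, is_pp (p i)) -> is_pp (pp_conj p A).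
Proof. by move=> pp; rewrite /pp_conj; elim: (enum A) => //= i s ->; rewrite pp. Qed.

Lemma pp_conjP (M : lmodType R) (e : nat -> M) (I : finType) (p : I -> mform R) A :
  mholds e (pp_conj p A) <-> forall i, i \in A -> mholds e (p i).
Proof.
have H s : mholds e (foldr (@MAnd R) (MEq MZero MZero) [seq p i | i <- s]) <->
    forall i, i \in s -> mholds e (p i).
  elim: s => [|i s IH] /=; first by split.
  rewrite IH; split=> [[hi hs] j|h].
    by rewrite inE => /orP [/eqP ->|/hs].
  by split=> [|j js]; apply: h; rewrite inE ?eqxx ?js ?orbT.
by rewrite /pp_conj H; split=> h i; have := h i; rewrite mem_enum.
Qed.

Definition pp_agree (M M' : lmodType R) (e : nat -> M) (e' : nat -> M') (I : Type)
    (p : I -> mform R) : Prop :=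
  forall i, mholds e (p i) <-> mholds e' (p i).

(* Baur-Monk elimination of quantifiers, in the form of a back-and-forth. *)
Lemma pp_elimination (f : mform R) :
  exists (I : finType) (p : I -> mform R), (forall i, is_pp (p i)) /\
    forall (M M' : lmodType R) (e : nat -> M) (e' : nat -> M'),
      free_like M -> free_like M' -> pp_agree e e' p ->
      mholds e f <-> mholds e' f.
Proof.
elim: f => [t1 t2|f [I [p [pp hp]]]|f [I [p [pp hp]]] g [J [q [pq hq]]]|n f [I [p [pp hp]]]].
- by exists unit, (fun=> MEq t1 t2); split=> // M M' e e' _ _ /(_ tt).
- exists I, p; split=> // M M' e e' hM hM' /(hp _ _ _ _ hM hM') /= E.
  by rewrite E.
- exists (I + J)%type, (fun k => match k with inl i => p i | inr j => q j end).
  split=> [[]//|M M' e e' hM hM' h] /=.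
  rewrite (hp _ _ e e') // => [|i]; last exact: (h (inl i)).
  by rewrite (hq _ _ e e') // => i; exact: (h (inr i)).
- exists {set I}, (fun A => MEx n (pp_conj p A)).
  split=> [A|M M' e e' hM hM' h] /=; first exact: pp_conj_pp.
  have main (N N' : lmodType R) (c : nat -> N) (c' : nat -> N') :
      free_like N -> free_like N' ->
      pp_agree c c' (fun A => MEx n (pp_conj p A)) ->
      (exists x, mholds (env_set c n x) f) -> exists x, mholds (env_set c' n x) f.
    move=> hN hN' hc [x hx].
    (* [A] records which [p i] hold at [x]; the value sought in [N'] has to satisfy these and no
       others. *)
    pose A : {set I} := finset (fun i => `[< mholds (env_set c n x) (p i) >]).
    have hA i : (i \in A) <-> mholds (env_set c n x) (p i).
      by rewrite inE; split=> [/asboolP|?]; last apply/asboolP.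
    have cA : mholds (env_set c n x) (pp_conj p A) by apply/pp_conjP => i /hA.
    have [|||x' [hx' hn]] := @coset_avoid N' c' n (pp_conj p A) I (~: A) p hN' _ pp.
    + exact: pp_conj_pp.
    + by have [+ _] := hc A; apply; exists x.
    (* If the subgroup of [pp_conj p A] lies in that of [p i] over [R], it does so in [N]. A common
       solution in [N'] yields one, [z], in [N]; then [x - z] lies in both subgroups, so [p i] holds
       at [x], although [i] is not in [A]. *)
    + move=> i iA hsub [y [hy hyi]].
      have [_] := hc (i |: A); case=> [|z hz].
        exists y; apply/pp_conjP => j; rewrite finset.in_setU1 => /orP [/eqP -> //|].
        by move/pp_conjP: hy; apply.
      have zi : mholds (env_set c n z) (p i).
        by move/pp_conjP: hz; apply; rewrite finset.setU11.
      have zA : mholds (env_set c n z) (pp_conj p A).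
        by apply/pp_conjP => j jA; move/pp_conjP: hz; apply; rewrite finset.setU1r.
      move: iA; rewrite inE => /negP; apply; apply/hA.
      have -> : x = z + (x - z) by rewrite addrC subrK.
      apply: coset_add => //; have [_ hN2] := hN.
      apply: (hN2 (pp_conj p A)) => //; first exact: pp_conj_pp.
      by apply: coset_diff cA zA; exact: pp_conj_pp.
    exists x'; rewrite -(hp _ _ (env_set c n x)) // => i; rewrite -hA.
    split=> [iA|hi]; first by move/pp_conjP: hx'; apply.
    by apply: contrapT => /negP iA; apply: hn hi; rewrite inE.
  split; apply: main => // A; exact: iff_sym.
Qed.

Lemma mholds_free_vars (M : lmodType R) (e e' : nat -> M) (f : mform R) :
  (forall i, i \in free_vars f -> e i = e' i) -> mholds e f <-> mholds e' f.
Proof.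
have T (c c' : nat -> M) t :
    (forall i, i \in mterm_vars t -> c i = c' i) -> meval c t = meval c' t.
  elim: t => [n||t1 IH1 t2 IH2|t IH|a t IH] //= h.
  - by apply: h; rewrite inE.
  - by rewrite IH1 ?IH2 // => i hi; apply: h; rewrite mem_cat hi ?orbT.
  - by rewrite IH.
  - by rewrite IH.
elim: f e e' => [t1 t2|f IH|f IHf g IHg|n f IH] e e' /= h.
- by rewrite (T e e' t1) 1?(T e e' t2) // => i hi; apply: h; rewrite mem_cat hi ?orbT.
- by rewrite (IH e e').
- by rewrite (IHf e e') 1?(IHg e e') // => i hi; apply: h; rewrite mem_cat hi ?orbT.
- have E x : mholds (env_set e n x) f <-> mholds (env_set e' n x) f.
    apply: IH => i hi; rewrite /env_set; case: eqP => // /eqP ni.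
    by apply: h; rewrite mem_filter ni.
  by split=> -[x /E]; exists x.
Qed.

(** A sentence may be evaluated at the zero assignments, where every positive primitive formula
    holds in every module, so that agreement on them is automatic. *)
Lemma free_like_equiv (M M' : lmodType R) (f : mform R) :
  free_like M -> free_like M' -> sentence f -> satisfies M f -> satisfies M' f.
Proof.
move=> hM hM' sf Mf e'; have [I [p [pp hp]]] := pp_elimination f.
apply/(@mholds_free_vars _ (fun=> 0)); first by rewrite sf.
rewrite -(hp M M' (fun=> 0)) // => i.
by split=> _; exact: pp0.
Qed.

Lemma section_freeMod p q n :
  is_pp p -> is_pp q -> (section p n : set R^o) `<=` section q n ->
  (section p n : set (freeMod R nat)) `<=` section q n.
Proof.
move=> pp pq h v hv; have [m hm] := freeMod_bound v.
rewrite (freeMod_nat_sum hm); apply: section_sum => // i.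
apply: (section_hom (cscale (delta R (i : nat))) (x := v i)) => //; apply: h.
exact: (section_hom (fcoord i)).
Qed.

Lemma free_like_freeMod : free_like (freeMod R nat).
Proof. by split; [exists idfun, idfun|exact: section_freeMod]. Qed.

Definition inl_mod (M N : lmodType R) (x : M) : (M * N)%type := (x, 0).
Lemma inl_mod_linear (M N : lmodType R) : linear (@inl_mod M N).
Proof. by move=> a x y; congr (_, _); rewrite /= scaler0 addr0. Qed.
HB.instance Definition _ (M N : lmodType R) :=
  GRing.isLinear.Build R M (M * N)%type *:%R (@inl_mod M N) (@inl_mod_linear M N).

Definition inr_mod (M N : lmodType R) (x : N) : (M * N)%type := (0, x).
Lemma inr_mod_linear (M N : lmodType R) : linear (@inr_mod M N).
Proof. by move=> a x y; congr (_, _); rewrite /= scaler0 addr0. Qed.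
HB.instance Definition _ (M N : lmodType R) :=
  GRing.isLinear.Build R N (M * N)%type *:%R (@inr_mod M N) (@inr_mod_linear M N).

Lemma free_like_prod (B : lmodType R) :
  (forall p q n, is_pp p -> is_pp q -> (section p n : set R^o) `<=` section q n ->
    (section p n : set B) `<=` section q n) ->
  free_like (freeMod R nat * B)%type.
Proof.
move=> hB; split.
  by exists (@inl_mod (freeMod R nat) B), fst.
move=> p q n pp pq h [x y] hxy.
have -> : (x, y) = inl_mod B x + inr_mod (freeMod R nat) y.
  by congr (_, _); rewrite /= ?addr0 ?add0r.
apply: sectionD => //; apply: section_hom => //.
- by apply: section_freeMod h _ _ => //; exact: (section_hom fst pp hxy).
- by apply: hB h _ _ => //; exact: (section_hom snd pp hxy).
Qed.

Lemma free_like_model (M : lmodType R) : free_like M -> model_of_free_theory M.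
Proof.
move=> hM f [sf hf]; apply: free_like_equiv sf _ => //.
  exact: free_like_freeMod.
apply: hf; exists nat, idfun; split; first exact: infinite_nat.
by exists idfun.
Qed.

End PositivePrimitive.

(** * Bass modules *)

Section BassEquality.
Variables (R : pzRingType) (b : nat -> R).
Notation B := (bassMod b).

(** For [i <= n], right multiplication by this product is the transition map from stage [i] to stage
    [n]. *)
Definition bass_prod (i n : nat) : R := \prod_(i.+1 <= j < n.+1) b j.

Lemma bass_prodS i n : (i <= n)%N -> bass_prod i n.+1 = bass_prod i n * b n.+1.
Proof. by move=> le_in; rewrite /bass_prod big_nat_recr. Qed.

Lemma bass_prod_id i : bass_prod i i = 1.
Proof. by rewrite /bass_prod big_geq. Qed.

Lemma bass_prod_recl i n : (i < n)%N -> bass_prod i n = b i.+1 * bass_prod i.+1 n.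
Proof. by move=> lt_in; rewrite /bass_prod big_ltn. Qed.

Lemma bass_prodM i k n :
  (i <= k)%N -> (k <= n)%N -> bass_prod i k * bass_prod k n = bass_prod i n.
Proof. by move=> ik kn; rewrite /bass_prod -big_cat_nat. Qed.

Lemma bass_in_prod i n (x : R) :
  (i <= n)%N -> bass_in b i x = bass_in b n (x * bass_prod i n).
Proof.
move=> /subnKC <-; elim: (n - i)%N => [|k IH]; first by rewrite addn0 bass_prod_id mulr1.
by rewrite addnS bass_prodS ?leq_addr // mulrA [RHS]bass_in_compat.
Qed.

(** Pushes the components at stages up to [n] forward to stage [n] and adds them. Later components
    are discarded, which is harmless once [n] is beyond the support. *)
Definition bass_comp (n : nat) : freeMod R nat -> R^o :=
  free_lift (fun i => if (i <= n)%N then bass_prod i n : R^o else 0).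
HB.instance Definition _ n := GRing.Linear.on (bass_comp n).

Lemma bass_comp_delta n i : (i <= n)%N -> bass_comp n (delta R i) = bass_prod i n.
Proof. by move=> le_in; rewrite /bass_comp free_lift_delta le_in. Qed.

Lemma bass_compZ n i (x : R) :
  (i <= n)%N -> bass_comp n (x *: delta R i) = x * bass_prod i n.
Proof. by move=> le_in; rewrite linearZ /= bass_comp_delta. Qed.

Lemma bass_comp_eq (u v : freeMod R nat) :
  proj (bass_rel b) u = proj (bass_rel b) v ->
  exists m, forall n, (m <= n)%N -> bass_comp n u = bass_comp n v.
Proof.
move=> /eqP; rewrite projE unfold_in => /asboolP.
move=> /(_ (fun w => exists m, forall n, (m <= n)%N -> bass_comp n w = 0)) [].
- split=> [|x y [m hm] [m' hm']|a x [m hm]].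
  + by exists 0%N => n _; rewrite raddf0.
  + exists (maxn m m') => n; rewrite geq_max => /andP [mn m'n].
    by rewrite raddfD /= hm // hm' // addr0.
  + by exists m => n mn; rewrite linearZ /= hm // scaler0.
- move=> r [i [x ->]]; exists i.+1 => n lt_in.
  by rewrite linearB /= !bass_compZ ?(ltnW lt_in) // bass_prod_recl // mulrA subrr.
- move=> m hm; exists m => n mn; apply/eqP; rewrite -subr_eq0 -raddfB /=.
  by rewrite hm.
Qed.

Lemma bass_in_eq i x y :
  bass_in b i x = bass_in b i y ->
  exists m, (i <= m)%N /\ x * bass_prod i m = y * bass_prod i m.
Proof.
move=> /bass_comp_eq [m hm]; exists (maxn i m); split; first exact: leq_maxl.
by have := hm _ (leq_maxr i m); rewrite !bass_compZ ?leq_maxl.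
Qed.

Lemma bass_in_surj (z : B) : exists i (x : R), z = bass_in b i x.
Proof.
rewrite -(proj_repr z); move: (repr z) => v; have [m hm] := freeMod_bound v.
rewrite (freeMod_nat_sum hm) raddf_sum.
apply: (big_ind (fun z : B => exists i (x : R), z = bass_in b i x)) => [|_ _ [i [x ->]] [j [y ->]]|i _].
- by exists 0%N, 0; rewrite raddf0.
- exists (maxn i j), (x * bass_prod i (maxn i j) + y * bass_prod j (maxn i j)).
  by rewrite raddfD /= -!bass_in_prod ?leq_maxl ?leq_maxr.
- by exists (i : nat), (v i).
Qed.

Lemma bass_in_scale i (x : R) : bass_in b i x = x *: bass_in b i 1.
Proof. by rewrite /bass_in scale1r linearZ. Qed.

Definition bass_hom i : R^o -> B := bass_in b i.
HB.instance Definition _ i :=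
  GRing.isLinear.Build R R^o B *:%R (bass_hom i) (bass_in_linear b i).

(** A positive primitive formula involves finitely many equations and witnesses, so its truth in the
    direct limit is attained at a finite stage. *)
Lemma bass_pp (p : mform R) i (u : nat -> R^o) : is_pp p ->
  mholds (bass_hom i \o u) p ->
  exists m, (i <= m)%N /\ mholds (fun n => u n * bass_prod i m : R^o) p.
Proof.
have shift (q : mform R) k m (w : nat -> R^o) : is_pp q ->
    mholds w q -> mholds (fun n => w n * bass_prod k m : R^o) q.
  by move=> pq; apply: (pp_hom (@cscale R R^o (bass_prod k m))).
have shiftM k m m' (w : nat -> R^o) : (k <= m)%N -> (m <= m')%N ->
    (fun n => w n * bass_prod k m * bass_prod m m') = (fun n => w n * bass_prod k m').
  by move=> km mm'; apply: funext => n; rewrite -mulrA bass_prodM.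
elim: p i u => [t1 t2|p IH|p IHp q IHq|n p IH] i u //=.
- rewrite !(meval_hom (bass_hom i) u) => _ H; have [m [im E]] := bass_in_eq H; exists m; split=> //.
  by rewrite !(meval_hom (@cscale R R^o (bass_prod i m)) u).
- move=> /andP [pp pq] [/(IHp _ _ pp) [m [im hm]] /(IHq _ _ pq) [m' [im' hm']]].
  exists (maxn m m'); split; first by rewrite leq_max im.
  by split; [rewrite -(@shiftM i m) ?leq_maxl //|rewrite -(@shiftM i m') ?leq_maxr //];
    apply: shift.
- move=> pp [z]; have [j [x ->]] := bass_in_surj z.
  pose k := maxn i j.
  have ik : (i <= k)%N := leq_maxl _ _.
  rewrite (bass_in_prod x (leq_maxr i j)) -/k => h.
  have [|m [km]] := IH k (env_set (fun n => u n * bass_prod i k : R^o) n (x * bass_prod j k)) pp.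
    move: h; congr mholds; apply: funext => l; rewrite /env_set /=.
    by case: eqP => // _; exact: bass_in_prod.
  move=> hm; exists m; split; first exact: leq_trans km.
  exists (x * bass_prod j k * bass_prod k m); move: hm; congr mholds.
  apply: funext => l; rewrite /env_set; case: eqP => // _.
  by rewrite -mulrA bass_prodM.
Qed.

Lemma section_bass p q n : is_pp p -> is_pp q ->
  (section p n : set R^o) `<=` section q n -> (section p n : set B) `<=` section q n.
Proof.
move=> pp pq h z hz; have [i [x zx]] := bass_in_surj z.
have [|m [im hm]] := @bass_pp p i (env_set (fun=> 0) n (x : R^o)) pp.
  move: hz; rewrite /section zx; congr mholds; apply: funext => l.
  by rewrite /env_set /=; case: eqP => // _; rewrite (raddf0 (bass_hom i)).
rewrite zx (bass_in_prod x im).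
apply: (section_hom (bass_hom m)) => //; apply: h.
move: hm; congr mholds; apply: funext => l.
by rewrite /env_set; case: eqP => // _; rewrite mul0r.
Qed.

Lemma bass_model : model_of_free_theory (freeMod R nat * B)%type.
Proof. by apply: free_like_model; apply: free_like_prod; exact: section_bass. Qed.

Lemma bass_countably_generated : countably_generated (freeMod R nat * B)%type.
Proof.
(* Even indices list the basis of the free module, odd indices the images of 1 from the successive
   stages. *)
pose e n : (freeMod R nat * B)%type :=
  if odd n then inr_mod (freeMod R nat) (bass_in b n./2 1) else inl_mod B (delta R n./2).
exists e => -[v z]; have [i [x zx]] := bass_in_surj z.
have [m hm] := freeMod_bound v.
pose N := (maxn m i.+1).*2.
pose c (j : nat) : R := if odd j then (if j./2 == i then x else 0) else v j./2.
exists N, (fun j => c j).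
rewrite -(big_mkord xpredT (fun j => c j *: e j)).
have split_sum K : \sum_(0 <= j < K.*2) c j *: e j =
    \sum_(0 <= k < K) (v k *: inl_mod B (delta R k)
      + (if k == i then x else 0) *: inr_mod (freeMod R nat) (bass_in b k 1)).
  elim: K => [|K IH]; first by rewrite !big_geq.
  rewrite doubleS !big_nat_recr //= IH -addrA; congr (_ + _).
  by rewrite /c /e /= !odd_double /= !doubleK uphalf_double.
rewrite /N split_sum big_split /= !big_mkord.
have -> : \sum_(k < maxn m i.+1) v k *: inl_mod B (delta R (k : nat)) = inl_mod B v.
  transitivity (inl_mod B (\sum_(k < maxn m i.+1) v k *: delta R (k : nat))).
    by rewrite linear_sum; apply: eq_bigr => k _; rewrite linearZ.
  by rewrite -freeMod_nat_sum // => j; rewrite geq_max => /andP [/hm].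
have lt_i : (i < maxn m i.+1)%N by rewrite leq_max ltnSn orbT.
rewrite (bigD1 (Ordinal lt_i)) //= eqxx big1 => [|k]; last first.
  by rewrite -val_eqE /= => /negPf ->; rewrite scale0r.
rewrite addr0 -linearZ -bass_in_scale -zx.
by congr (_, _); rewrite /= ?addr0 ?add0r.
Qed.

End BassEquality.

(** * Flatness *)

Section TensorTheory.
Variable R : pzRingType.

HB.instance Definition _ (M : lmodType R) (N N' : lmodType R^c) (f : {linear N -> N'}) :=
  GRing.isLinear.Build int (tensor M N) (tensor M N') *:%R
    (@tensor_map R M N N' f) (tensor_map_linear f).

Section Pure.
Variables (M : lmodType R) (N : lmodType R^c).

Definition purel (y : M) (x : N) : tensor M N := pure x y.
Lemma purel_is_zmod_morphism y : zmod_morphism (purel y).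
Proof.
move=> x x'; apply/eqP; rewrite eq_sym subr_eq; apply/eqP.
by rewrite /purel -pureDl subrK.
Qed.
HB.instance Definition _ y :=
  GRing.isZmodMorphism.Build N (tensor M N) (purel y) (purel_is_zmod_morphism y).

Definition purer (x : N) (y : M) : tensor M N := pure x y.
Lemma purer_is_zmod_morphism x : zmod_morphism (purer x).
Proof.
move=> y y'; apply/eqP; rewrite eq_sym subr_eq; apply/eqP.
by rewrite /purer -pureDr subrK.
Qed.
HB.instance Definition _ x :=
  GRing.isZmodMorphism.Build M (tensor M N) (purer x) (purer_is_zmod_morphism x).

Lemma pure0l (y : M) : pure (0 : N) y = 0. Proof. exact: (raddf0 (purel y)). Qed.

Lemma tensor_ind (P : tensor M N -> Prop) :
  P 0 -> (forall t u, P t -> P u -> P (t + u)) -> (forall x y, P (pure x y)) ->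
  forall t, P t.
Proof.
move=> P0 PD Ppure t; rewrite -(proj_repr t); move: (repr t) => v.
rewrite (freeMod_gen v); have /finite_seqP [s hs] := freeMod_finite v.
rewrite (@free_lift_seq _ _ _ _ (undup s)) ?undup_uniq //; last first.
  by move=> i vi; rewrite mem_undup; have : [set` s] i by rewrite -hs.
rewrite linear_sum; apply: (big_ind P) => // -[x y] _.
have Pscale (n : int) x' y' : P (n *: pure x' y').
  by rewrite -[n]intz scaler_int -[pure _ _]/(purel y' x') -raddfMz; exact: Ppure.
rewrite linearZ_LR; exact: Pscale.
Qed.

End Pure.

Lemma tensor_ext (M : lmodType R) (N : lmodType R^c) (V : lmodType int)
    (h k : {linear tensor M N -> V}) :
  (forall x y, h (pure x y) = k (pure x y)) -> h =1 k.
Proof.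
move=> hk t; elim/tensor_ind: t => // [|t u IHt IHu]; first by rewrite !raddf0.
by rewrite !linearD IHt IHu.
Qed.

Section MapRight.
Variables (M M' : lmodType R) (h : {linear M -> M'}) (N : lmodType R^c).

Definition tensor_mapr : tensor M N -> tensor M' N :=
  tensor_lift (fun x y => pure x (h y)).

Lemma tensor_mapr_linear : linear tensor_mapr.
Proof.
apply: tensor_lift_linear => [x x' y|x y y'|x a y].
- exact: pureDl.
- by rewrite raddfD pureDr.
- by rewrite pureA linearZ.
Qed.
HB.instance Definition _ :=
  GRing.isLinear.Build int (tensor M N) (tensor M' N) *:%R
    tensor_mapr tensor_mapr_linear.

Lemma tensor_mapr_pure x y : tensor_mapr (pure x y) = pure x (h y).
Proof.
apply: tensor_lift_pure => [x1 x' y1|x1 y1 y'|x1 a y1].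
- exact: pureDl.
- by rewrite raddfD pureDr.
- by rewrite pureA linearZ.
Qed.

End MapRight.

Lemma tensor_mapC (M M' : lmodType R) (h : {linear M -> M'})
    (N N' : lmodType R^c) (f : {linear N -> N'}) (t : tensor M N) :
  tensor_map f (tensor_mapr h t) = tensor_mapr h (tensor_map f t).
Proof.
apply: (tensor_ext (h := tensor_map f \o @tensor_mapr _ _ h N)
                   (k := @tensor_mapr _ _ h N' \o tensor_map f)) => x y /=.
by rewrite tensor_mapr_pure !tensor_map_pure tensor_mapr_pure.
Qed.

Lemma flat_ker (M : lmodType R) :
  (forall (N N' : lmodType R^c) (f : {linear N -> N'}), injective f ->
     forall t : tensor M N, tensor_map f t = 0 -> t = 0) -> flat M.
Proof.
move=> hM N N' f fi t u /eqP; rewrite -subr_eq0 -raddfB => /eqP /(hM _ _ _ fi) /eqP.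
by rewrite subr_eq0 => /eqP.
Qed.

Lemma flat_map0 (M : lmodType R) (N N' : lmodType R^c) (f : {linear N -> N'}) t :
  flat M -> injective f -> tensor_map (M := M) f t = 0 -> t = 0.
Proof. by move=> hM fi ft; apply: (hM _ _ f fi); rewrite ft raddf0. Qed.

Definition ract (N : lmodType R^c) (x : N) (r : R) : zmodule N := (r : R^c) *: x.

Lemma ractDl (N : lmodType R^c) (x x' : N) r : ract (x + x') r = ract x r + ract x' r.
Proof. by rewrite /ract scalerDr. Qed.
Lemma ractDr (N : lmodType R^c) (x : N) r r' : ract x (r + r') = ract x r + ract x r'.
Proof. by rewrite /ract scalerDl. Qed.
Lemma ractA (N : lmodType R^c) (x : N) (a r : R) : ract ((a : R^c) *: x) r = ract x (a * r).
Proof. exact: (scalerA (r : R^c) (a : R^c) x). Qed.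

(** The action map [mu] identifies the tensor product of [N] and [R] with [N], naturally in [N]. *)
Lemma flat_regular : flat (R^o : lmodType R).
Proof.
apply: flat_ker => N N' f fi t.
pose mu (K : lmodType R^c) : tensor R^o K -> zmodule K := 
    tensor_lift (M := (R^o : lmodType R)) (V := (zmodule K : lmodType int)) (@ract K).
have muP (K : lmodType R^c) (x : K) r : mu K (pure x r) = ract x r.
  by apply: tensor_lift_pure => *; [exact: ractDl|exact: ractDr|exact: ractA].
have muL K : linear (mu K).
  by apply: tensor_lift_linear => *; [exact: ractDl|exact: ractDr|exact: ractA].
have mu0 K : mu K 0 = 0 by rewrite -[0](subrr 0) -scaleN1r addrC muL scaleN1r addNr.
have muD K u v : mu K (u + v) = mu K u + mu K v by rewrite -[u]scale1r muL !scale1r.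
have tE (K : lmodType R^c) (u : tensor R^o K) : u = pure (mu K u : K) (1 : R^o).
  elim/tensor_ind: u => [|u v IHu IHv|x r].
  - by rewrite mu0 pure0l.
  - by rewrite muD pureDl -IHu -IHv.
  - by rewrite muP pureA; congr pure; rewrite /GRing.scale /= mulr1.
have fmu u : mu N' (tensor_map f u) = f (mu N u).
  elim/tensor_ind: u => [|u v IHu IHv|x r].
  - by rewrite raddf0 !mu0 raddf0.
  - by rewrite raddfD !muD IHu IHv raddfD.
  - by rewrite tensor_map_pure !muP /ract linearZ.
move=> ft; rewrite (tE _ t) (_ : mu N t = 0) ?pure0l //.
by apply: fi; rewrite -fmu ft mu0 raddf0.
Qed.

(** Every tensor is a finite sum of images of its coordinates, which live in tensor products with
    [R]. By naturality each coordinate is killed by [f] as well, and [R] is flat. *)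
Lemma flat_freeMod : flat (freeMod R nat).
Proof.
apply: flat_ker => N N' f fi t ft.
pose inj i : {linear R^o -> freeMod R nat} := cscale (delta R (i : nat)).
have [m hm] : exists m, forall n, (m <= n)%N ->
    t = \sum_(i < n) tensor_mapr (inj i) (tensor_mapr (fcoord (i : nat)) t).
  move: t {ft}; apply: tensor_ind => [|t u [m hm] [m' hm']|x v].
  - by exists 0%N => n _; rewrite big1 // => i _; rewrite !raddf0.
  - exists (maxn m m') => n; rewrite geq_max => /andP [mn m'n].
    rewrite {1}(hm n mn) {1}(hm' n m'n) -big_split.
    by apply: eq_bigr => i _; rewrite !raddfD.
  - have [m hm] := freeMod_bound v; exists m => n mn.
    rewrite {1}(@freeMod_nat_sum _ v n) => [|j nj]; last exact/hm/(leq_trans mn).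
    rewrite -[LHS]/(purer x _) raddf_sum; apply: eq_bigr => i _.
    by rewrite !tensor_mapr_pure.
rewrite (hm m) // big1 // => i _.
rewrite (_ : tensor_mapr _ t = 0) ?raddf0 //.
apply: (flat_map0 flat_regular fi).
by rewrite tensor_mapC ft raddf0.
Qed.

Lemma flat_prod (M M' : lmodType R) : flat M -> flat M' -> flat (M * M')%type.
Proof.
move=> hM hM'; apply: flat_ker => N N' f fi t ft.
have -> : t = tensor_mapr (@inl_mod _ M M') (tensor_mapr fst t)
            + tensor_mapr (@inr_mod _ M M') (tensor_mapr snd t).
  move: t {ft}; apply: tensor_ind => [|t u IHt IHu|x [y z]].
  - by rewrite !raddf0 addr0.
  - by rewrite {1}IHt {1}IHu !raddfD addrACA.
  - rewrite !tensor_mapr_pure -pureDr; congr pure.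
    by congr (_, _); rewrite /= ?addr0 ?add0r.
rewrite (flat_map0 hM fi (t := tensor_mapr fst t)) ?raddf0; last first.
  by rewrite tensor_mapC ft raddf0.
rewrite (flat_map0 hM' fi (t := tensor_mapr snd t)) ?raddf0 ?addr0 //.
by rewrite tensor_mapC ft raddf0.
Qed.

(** * Flatness of Bass modules *)

Section FlatBass.
Variable b : nat -> R.

Definition ev_zero (N : lmodType R^c) : set (nat -> zmodule N) :=
  [set s | exists m, forall n, (m <= n)%N -> s n = 0].

Lemma gen_ev_zero (N : lmodType R^c) (s : nat -> zmodule N) :
  s \in gen_submod (@ev_zero N) -> exists m, forall n, (m <= n)%N -> s n = 0.
Proof.
rewrite unfold_in => /asboolP h; apply: (h (@ev_zero N)) => //; split.
- by exists 0%N.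
- move=> u v [m hm] [m' hm']; exists (maxn m m') => n; rewrite geq_max => /andP [mn m'n].
  by rewrite -[LHS]/(u n + v n) hm // hm' // addr0.
- by move=> a u [m hm]; exists m => n mn; rewrite -[LHS]/(a *: u n) hm // scaler0.
Qed.

(* An element of the tensor product with the limit is read off, eventually, from
   its images at the finite stages. *)
Definition bass_seq (N : lmodType R^c) (x : N) (z : bassMod b) :
  quotMod (@ev_zero N) := proj (@ev_zero N) (fun n => ract x (bass_comp b n (repr z))).

Lemma ev_zero_eq (N : lmodType R^c) (s u : nat -> zmodule N) :
  (exists m, forall n, (m <= n)%N -> s n = u n) ->
  proj (@ev_zero N) s = proj (@ev_zero N) u.
Proof.
move=> [m hm]; apply/eqP; rewrite projE; apply: sub_gen_submod.
by exists m => n mn; rewrite -[LHS]/(s n - u n) hm // subrr.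
Qed.

Lemma bass_seqE (N : lmodType R^c) (x : N) v :
  bass_seq x (proj (bass_rel b) v) = proj (@ev_zero N) (fun n => ract x (bass_comp b n v)).
Proof.
apply: ev_zero_eq; have [|m hm] := @bass_comp_eq _ b (repr (proj (bass_rel b) v)) v.
  exact: proj_repr.
by exists m => n mn; rewrite hm.
Qed.

Lemma bass_seqDl (N : lmodType R^c) (x x' : N) z : bass_seq (x + x') z = bass_seq x z + bass_seq x' z.
Proof.
by rewrite /bass_seq -projD; congr proj; apply: funext => n; exact: ractDl.
Qed.

Lemma bass_seqDr (N : lmodType R^c) (x : N) z z' : bass_seq x (z + z') = bass_seq x z + bass_seq x z'.
Proof.
rewrite -(proj_repr z) -(proj_repr z') -projD !bass_seqE -projD; congr proj.
by apply: funext => n; rewrite raddfD; exact: ractDr.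
Qed.

Lemma bass_seqA (N : lmodType R^c) (x : N) (a : R) z : bass_seq ((a : R^c) *: x) z = bass_seq x (a *: z).
Proof.
rewrite -(proj_repr z) -linearZ !bass_seqE; congr proj.
by apply: funext => n; rewrite ractA linearZ.
Qed.

Lemma tensor_bass (N : lmodType R^c) (t : tensor (bassMod b) N) :
  exists m, forall n, (m <= n)%N -> exists x, t = pure x (bass_in b n 1).
Proof.
elim/tensor_ind: t => [|t u [m hm] [m' hm']|x z].
- by exists 0%N => n _; exists 0; rewrite pure0l.
- exists (maxn m m') => n; rewrite geq_max => /andP [/hm [x ->] /hm' [y ->]].
  by exists (x + y); rewrite pureDl.
- have [m [r ->]] := bass_in_surj z; exists m => n mn.
  exists (((r * bass_prod b m n) : R^c) *: x).
  by rewrite (bass_in_prod b r mn) bass_in_scale pureA.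
Qed.

(** A tensor has the form [pure x (bass_in b m 1)]. If its image vanishes, then [bass_prod b m n]
    kills [f x] for some [n], hence kills [x], and moving this product across the tensor sign shows
    that the tensor is 0. *)
Lemma flat_bass : flat (bassMod b).
Proof.
apply: flat_ker => N N' f fi t; have [m /(_ m (leqnn m)) [x ->]] := tensor_bass t.
rewrite tensor_map_pure => h0.
have : tensor_lift (@bass_seq N') (pure (f x) (bass_in b m 1)) = 0.
  rewrite h0; have L : linear (tensor_lift (@bass_seq N')).
    by apply: tensor_lift_linear; [exact: bass_seqDl|exact: bass_seqDr|exact: bass_seqA].
  by rewrite -[0](subrr 0) -scaleN1r addrC L scaleN1r addNr.
rewrite tensor_lift_pure; [|exact: bass_seqDl|exact: bass_seqDr|exact: bass_seqA].
rewrite bass_seqE -(raddf0 (proj (@ev_zero N'))) => /eqP; rewrite projE subr0.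
move=> /gen_ev_zero [k hk]; pose n := maxn m k.
have := hk n (leq_maxr m k); rewrite bass_compZ ?leq_maxl // mul1r /ract -linearZ => fx.
have {}fx : (bass_prod b m n : R^c) *: x = 0 by apply: fi; rewrite fx raddf0.
by rewrite (bass_in_prod b 1 (leq_maxl m k)) mul1r bass_in_scale -pureA fx pure0l.
Qed.

End FlatBass.
End TensorTheory.

(** * Rings with the minimum condition on principal right ideals *)

Section MinimumCondition.
Variable R : pzRingType.

(** Minimality of [a R] among the right ideals [x R] with [x] in [X], put in terms of elements:
    those inside [a R] are generated by some [a * r]. *)
Definition minimum_condition : Prop :=
  forall X : set R, X !=set0 ->
    exists a, X a /\ forall r, X (a * r) -> exists s, a = a * r * s.

Lemma bass_chain_stops (a b : nat -> R) :
  bass_chain a b -> projective (freeMod R nat * bassMod b)%type ->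
  exists m, forall n, exists s, a m = a n * s.
Proof.
move=> [a0 aS] pB.
have aE n : a n = bass_prod b 0 n.
  by elim: n => [|n IH]; rewrite ?a0 ?bass_prod_id // aS IH bass_prodS.
have [|h hh] := pB (freeMod R nat) (bassMod b) (proj (bass_rel b)) snd.
  by move=> z; exists (repr z); exact: proj_repr.
pose v n := h (inr_mod (freeMod R nat) (bass_in b n 1)).
have v0 n : v 0%N = a n *: v n.
  rewrite /v (bass_in_prod b 1 (leq0n n)) mul1r -aE bass_in_scale.
  by rewrite [inr_mod _ _]linearZ linearZ.
(* [v 0] and [delta R 0] have the same image in the limit, hence agree from some stage on. At stage
   [m] the latter gives [a m], the former a right multiple of [a n]. *)
have [m hm] : exists m, forall n, (m <= n)%N ->
    bass_comp b n (v 0%N) = bass_comp b n (1 *: delta R 0%N).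
  by apply: bass_comp_eq; rewrite [LHS]hh.
exists m => n; exists (bass_comp b m (v n)).
by have := hm m (leqnn m); rewrite bass_compZ // mul1r -aE => <-; rewrite (v0 n) linearZ.
Qed.

Lemma bass_minimum_condition :
  (forall a b : nat -> R, bass_chain a b ->
     projective (freeMod R nat * bassMod b)%type) -> minimum_condition.
Proof.
move=> pB X [x Xx]; apply: contrapT => noMin.
have /choice [phi hphi] a : exists r, X a -> X (a * r) /\ forall s, a <> a * r * s.
  have [Xa|nXa] := pselect (X a); last by exists 0.
  apply: contrapT => /forallNP h; apply: noMin; exists a; split=> // r Xar.
  apply: contrapT => /forallNP h'; exact: (h r).
pose c n := iter n (fun y => y * phi y) x.
have Xc n : X (c n) by elim: n => //= n /hphi [].
pose a n := if n is k.+1 then c k else 1.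
pose b n := match n with 0 => 1 | 1 => x | k.+2 => phi (c k) end.
have ab : bass_chain a b by split=> // -[|n] //=; rewrite mul1r.
have [m hm] := bass_chain_stops ab (pB a b ab).
(* Since [a m.+2] is [c m * phi (c m)], the stop at [m] would put [c m], which is [a m.+1], into the
   right ideal that [c m * phi (c m)] generates. *)
have [s hs] := hm m.+2; have [_ /(_ (s * b m.+1))] := hphi _ (Xc m); apply.
have [_ aS] := ab.
by rewrite -[LHS]/(a m.+1) aS hs mulrA.
Qed.

End MinimumCondition.

(** * The Jacobson radical, Nakayama's lemma and local idempotents *)

Section Radical.
Variable R : pzRingType.
Implicit Types a r s t j : R.

Definition Jac a : Prop := forall s, exists t, t * (1 - s * a) = 1.

Lemma JacMl r a : Jac a -> Jac (r * a).
Proof. by move=> ja s; rewrite mulrA. Qed.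

Lemma Jac0 : Jac 0.
Proof. by move=> s; exists 1; rewrite mulr0 subr0 mul1r. Qed.

Lemma JacD a b : Jac a -> Jac b -> Jac (a + b).
Proof.
move=> ja jb s; have [t ht] := ja s; have [t' ht'] := jb (t * s).
by exists (t' * t); rewrite [s * _]mulrDr opprD addrA -mulrA mulrBr ht mulrA.
Qed.

Lemma JacN a : Jac a -> Jac (- a).
Proof. by rewrite -mulN1r; exact: JacMl. Qed.

Lemma JacMr r a : Jac a -> Jac (a * r).
Proof.
(* [t] is a left inverse of [1 - r s a]; the identity relating inverses of [1 - x y] and [1 - y x]
   turns it into one of [1 - s a r]. *)
move=> ja s; have [t ht] := ja (r * s); exists (1 + s * a * t * r).
have E : s * a * t * r * (1 - s * (a * r)) = s * (a * r).
  rewrite -mulrA (_ : r * _ = (1 - r * s * a) * r).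
    by rewrite -mulrA [t * _]mulrA ht mul1r mulrA.
  by rewrite mulrBr mulrBl mulr1 mul1r !mulrA.
by rewrite mulrDl mul1r E subrK.
Qed.

(** A left inverse [t] of [1 - j] equals [1 + t j] and so has a left inverse itself, which must be
    [1 - j]. *)
Lemma Jac_unit j : Jac j -> exists t, (1 - j) * t = 1.
Proof.
move=> jj; have [t] := jj 1; rewrite mul1r => ht; exists t.
have tE : t = 1 + t * j by rewrite -{1}ht mulrBr mulr1 subrK.
have [t'] := JacN (JacMl t jj) 1; rewrite mul1r opprK -tE => ht'.
by have -> : 1 - j = t' by rewrite -[RHS]mulr1 -{2}ht mulrA ht' mul1r.
Qed.

Lemma Jac_absorb a j s : Jac j -> a = a * j * s -> a = 0.
Proof.
move=> jj aE; have [t ht] := Jac_unit (JacMr s jj).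
rewrite -[a]mulr1 -ht mulrA (_ : a * (1 - j * s) = 0) ?mul0r //.
by rewrite mulrBr mulr1 mulrA -aE subrr.
Qed.

(** This rests on [(1 + s a) (1 - s a) = 1 - s (a s a)]. *)
Lemma Jac_semiprime a : ~ Jac a -> exists s, ~ Jac (a * s * a).
Proof.
move=> na; apply: contrapT => /forallNP h; apply: na => s.
have /contrapT /(_ s) [t ht] := h s; exists (t * (1 + s * a)).
rewrite -mulrA (_ : _ * (1 - s * a) = 1 - s * (a * s * a)) //.
by rewrite mulrDl mul1r mulrBr mulr1 addrA subrK !mulrA.
Qed.

(* The Jacobson radical as a right ideal, i.e. as a submodule of R as a
   module over the converse ring. *)
Definition jac : {pred R^c^o} := fun a => `[< Jac a >].

Lemma jac_submod : submod_closed jac.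
Proof.
split=> [|a x y]; rewrite !unfold_in; first exact/asboolP/Jac0.
by move=> /asboolP jx /asboolP jy; apply/asboolP/JacD => //; exact: (JacMr a jx).
Qed.

HB.instance Definition _ := GRing.isSubmodClosed.Build R^c R^c^o jac jac_submod.

Record jacMod := JacMod { jac_val : R^c^o ; _ : jac_val \in jac }.

HB.instance Definition _ := [isSub for jac_val].
HB.instance Definition _ := [Choice of jacMod by <:].
HB.instance Definition _ := [SubChoice_isSubLmodule of jacMod by <:].

Lemma jac_valP (x : jacMod) : Jac (jac_val x).
Proof. by have := valP x; rewrite unfold_in => /asboolP. Qed.

Hypothesis minR : minimum_condition R.

Definition JM (M : lmodType R) (K : set M) : set M :=
  [set z | exists j y, [/\ Jac j, K y & z = j *: y]].

(** Take [a] with [a R] minimal among the elements not killing [K]. If [a j z] were nonzero with [j]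
    radical and [z] in [K], then [a] would lie in [a j R] and vanish; so [a] kills [J K] and with it
    [K]. *)
Lemma nakayama (M : lmodType R) (K : set M) :
  (forall x, K x -> x \in gen_submod (JM K)) -> forall x, K x -> x = 0.
Proof.
move=> hK x Kx; apply/eqP; apply: contraT => /eqP x0.
have [|a [[y [Ky ay]] amin]] := minR (X := [set a | exists x, K x /\ a *: x <> 0]).
  by exists 1, x; rewrite scale1r.
exfalso; have [[j [z [jj Kz ajz]]]|h] :=
    pselect (exists j z, [/\ Jac j, K z & a *: (j *: z) <> 0]).
  have [|s /(Jac_absorb jj) a0] := amin j; first by exists z; rewrite -scalerA.
  by apply: ay; rewrite a0 scale0r.
apply: ay; rewrite -[y]scale1r.
have := hK y Ky; rewrite unfold_in => /asboolP /(_ [set w | forall r, a *: (r *: w) = 0]).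
apply=> [|_ [j [z [jj Kz ->]]] r /=].
- split=> [r|u v hu hv r|b u hu r] /=; first by rewrite !scaler0.
  + by rewrite !scalerDr hu hv addr0.
  + by rewrite [r *: _]scalerA hu.
- rewrite [r *: _]scalerA; apply: contrapT => arz; apply: h; exists (r * j), z.
  by split=> //; exact: JacMl.
Qed.

Lemma Jac_nil a : Jac a -> exists n, a ^+ n = 0.
Proof.
move=> ja; have [|_ [[n ->] hn]] := minR (X := [set x | exists n, x = a ^+ n]).
  by exists 1, 0%N.
have [|s /(Jac_absorb ja)] := hn a; first by exists n.+1; rewrite exprSr.
by exists n.
Qed.

Lemma exp_1B (c : R) n : exists g, GRing.comm c g /\ (1 - c) ^+ n = 1 - c * g.
Proof.
elim: n => [|n [g [cg hg]]].
  by exists 0; split; [exact: commr0|rewrite mulr0 subr0].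
exists (1 + g - g * c); split.
  by apply: commrB; [apply: commrD => //; exact: commr1|apply: commrM].
rewrite exprSr hg mulrBr mulr1 mulrBl mul1r mulrBr mulrDr mulr1 mulrA.
by rewrite !opprD !opprK !addrA; congr (_ + _); rewrite addrAC.
Qed.

(* If [(c - c ^ 2) ^ n = 0], then [(1 - (1 - c) ^ n) ^ n.+1] is an idempotent. *)
Lemma lift_idempotent (c : R) : Jac (c - c * c) -> ~ Jac c ->
  exists q, c * q * (c * q) = c * q /\ ~ Jac (c * q).
Proof.
move=> jc nc; have [n hn] := Jac_nil jc.
have [g [cg hg]] := exp_1B c n.
have c1 : GRing.comm c (1 - c) by apply: commrB; [exact: commr1|].
have cE : c ^+ n = c ^+ n * (c * g).
  have : c ^+ n * (1 - c) ^+ n = 0 by rewrite -exprMn_comm // mulrBr mulr1.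
  by rewrite hg mulrBr mulr1 => /eqP; rewrite subr_eq0 => /eqP.
have cEk k : c ^+ n = c ^+ n * (c * g) ^+ k.
  by elim: k => [|k IH]; rewrite ?mulr1 // exprS mulrA -cE.
pose e := (c * g) ^+ n.+1.
have [q eE] : exists q, e = c * q by exists (g * (c * g) ^+ n); rewrite /e exprS mulrA.
have ec : exists u, e = u * c ^+ n.
  exists (c * g * g ^+ n); rewrite /e exprS exprMn_comm //.
  by rewrite (commrX n (commr_sym (commrX n (commr_sym cg)))) mulrA.
exists q; rewrite -eE; split.
  by have [u ue] := ec; rewrite {1}ue -mulrA -cEk -ue.
(* If [e] were radical, [c ^+ n = c ^+ n * e] would vanish. As [c - c * c] is radical, membership in
   the radical then descends through the powers of [c] to [c] itself. *)
move=> je; apply: nc.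
have cn0 : c ^+ n = 0.
  by apply: (Jac_absorb (s := 1) je); rewrite mulr1 -cEk.
have : Jac (c ^+ n.+1) by rewrite exprS cn0 mulr0; exact: Jac0.
elim: (n) => // k IH jk; apply: IH.
rewrite (_ : c ^+ k.+1 = c ^+ k.+2 + c ^+ k * (c - c * c)).
  by apply: JacD => //; exact: JacMl.
by rewrite mulrBr !mulrA -!exprSr addrC subrK.
Qed.

(** The right ideal [e R] is minimal among the principal ones outside the radical [J], so
    [e R / e J] is simple. *)
Definition local_idempotent (e : R) : Prop :=
  [/\ e * e = e, ~ Jac e & forall r, ~ Jac (e * r) -> exists s, e = e * r * s].

(** The left-hand counterpart, simplicity of [R e / J e]. Semiprimeness moves [r] into [e R e]
    without making it radical; there non-radical elements have right inverses, hence two-sided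
    ones. *)
Lemma local_idempotent_left e r :
  local_idempotent e -> r * e = r -> ~ Jac r -> exists s, s * r = e.
Proof.
move=> [ee ne emin] re nr; have [y ny] := Jac_semiprime nr.
have nx : ~ Jac (e * (y * r)).
  by move=> /(JacMl r); rewrite !mulrA re.
have [s hs] := emin _ nx.
pose x := e * (y * r); have xe : x * e = x by rewrite /x -!mulrA re.
pose u := e * s * e.
have xu : x * u = e by rewrite /u !mulrA xe -hs ee.
have eu : e * u = u by rewrite /u !mulrA ee.
have ue : u * e = u by rewrite /u -!mulrA ee.
have [|w hw] := emin u.
  by rewrite eu => ju; apply: ne; rewrite -xu; exact: JacMl.
have ux : u * x = e.
  have xw : x = e * w by rewrite -xe {1}hw eu mulrA xu.
  by rewrite xw mulrA ue -eu -hw.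
by exists (u * e * y); rewrite -(mulrA _ y) -(mulrA u).
Qed.

(** A minimal [a] outside the radical with [f a = a] can be written [a s a t]. Then [c = a t s] is
    idempotent modulo the radical, and the idempotent lifted from it lies in [a R]. *)
Lemma local_idempotent_below f :
  ~ Jac f -> f * f = f -> exists e, local_idempotent e /\ f * e = e.
Proof.
move=> nf ff; have [|a [[na fa] amin]] := minR (X := [set a | ~ Jac a /\ f * a = a]).
  by exists f.
have {}amin r : ~ Jac (a * r) -> exists s, a = a * r * s.
  by move=> nar; apply: amin; split=> //; rewrite mulrA fa.
have [s ns] := Jac_semiprime na.
have [|t ht] := amin (s * a); first by rewrite mulrA.
pose u := a * s; pose c := a * (t * s).
have uc : u * c = u by rewrite /u /c {3}ht !mulrA.
have nc : ~ Jac c.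
  by move=> jc; apply: ns; rewrite -/u -uc; apply: JacMr; exact: JacMl.
(* [u * c = u] means that [u] kills [c - c * c]. Were this element not radical, [a] would be a right
   multiple of it and [u * a] would be 0. *)
have jc : Jac (c - c * c).
  apply: contrapT => njc; have [|s'] := amin (t * s - t * s * c).
    by rewrite mulrBr [a * (_ * c)]mulrA.
  rewrite mulrBr [a * (_ * c)]mulrA -/c => aE; apply: ns; rewrite -/u aE mulrA.
  by rewrite mulrBr mulrA !uc subrr mul0r; exact: Jac0.
have [q [qq nq]] := lift_idempotent jc nc.
have eE : c * q = a * (t * s * q) by rewrite /c -!mulrA.
exists (c * q); split; last by rewrite eE mulrA fa.
split=> // r ner; have [|s' hs'] := amin (t * s * q * r).
  by rewrite mulrA -eE.
by exists (s' * (t * s * q)); rewrite eE {1}hs' !mulrA.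
Qed.

(** Otherwise take an idempotent [f] with [f M] nonzero and [f R] minimal. A local idempotent [e] in
    [f R] kills [M], so [f - e f] still acts nontrivially; minimality forces [e f = 0], hence
    [e = 0], which is absurd. *)
Lemma local_idempotent_acts (M : lmodType R) (x : M) :
  (forall j (y : M), Jac j -> j *: y = 0) -> x <> 0 ->
  exists e (y : M), local_idempotent e /\ e *: y <> 0.
Proof.
move=> JM0 x0; apply: contrapT => no.
have kills e (y : M) : local_idempotent e -> e *: y = 0.
  by move=> le; apply: contrapT => ey; apply: no; exists e, y.
have [|f [[ff [y fy]] fmin]] :=
    minR (X := [set f | f * f = f /\ exists y : M, f *: y <> 0]).
  by exists 1; split; [rewrite mulr1|exists x; rewrite scale1r].
have nf : ~ Jac f by move=> jf; apply: fy; exact: JM0.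
have [e [le fe]] := local_idempotent_below nf ff.
pose e' := e * f.
have fe' : f * e' = e' by rewrite /e' mulrA fe.
have e'f : e' * f = e' by rewrite /e' -mulrA ff.
have [ee ne _] := le.
have e'e' : e' * e' = e' by rewrite /e' mulrA -(mulrA e) fe ee.
have e'0 : e' * (f - e') = 0 by rewrite mulrBr e'f e'e' subrr.
have [|s hs] := fmin (f - e').
  rewrite mulrBr ff fe'; split.
    by rewrite mulrBl !mulrBr ff fe' e'f e'e' subrr subr0.
  by exists y; rewrite scalerBl /e' -[(e * f) *: _]scalerA (kills e) // subr0.
have e'z : e' = 0 by rewrite -e'f hs !mulrA e'f e'0 mul0r.
apply: ne; rewrite -ee -{2}fe mulrA -/e' e'z mul0r; exact: Jac0.
Qed.

End Radical.

(** * Flat modules over rings with the minimum condition *)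

Lemma free_lift_fsupp (R : pzRingType) (I : choiceType) (v : freeMod R I) :
  exists s : seq I, [/\ uniq s, forall i, (v i != 0) = (i \in s)
    & forall (V : lmodType R) (g : I -> V), free_lift g v = \sum_(i <- s) v i *: g i].
Proof.
have /finite_seqP [s hs] := freeMod_finite v.
have E i : (v i != 0) = (i \in undup s).
  rewrite mem_undup; apply/idP/idP => [vi|is'].
    by have : [set` s] i by rewrite -hs.
  by have : [set i | v i != 0] i by rewrite hs.
exists (undup s); split=> //; first exact: undup_uniq.
by move=> V g; apply: free_lift_seq => [|i]; rewrite ?undup_uniq // E.
Qed.

Lemma projective_retract (R : pzRingType) (I : choiceType) (M : lmodType R)
    (g : I -> M) (s : M -> freeMod R I) :
  linear s -> (forall x, free_lift g (s x) = x) -> projective M.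
Proof.
move=> sl gs N N' p f psurj.
have /choice [k hk] i : exists y, p y = f (g i) by exact: psurj.
pose sL : {linear M -> freeMod R I} :=
  HB.pack s (GRing.isLinear.Build R M (freeMod R I) *:%R s sl).
exists (free_lift k \o sL) => x /=.
have E : p \o free_lift k =1 f \o free_lift g.
  apply: (freeMod_ext (h := p \o free_lift k) (k := f \o free_lift g)) => i /=.
  by rewrite !free_lift_delta.
by rewrite -{2}(gs x); exact: E.
Qed.

Section GenSubmod.
Variables (R : pzRingType) (M : lmodType R) (S : set M).

Lemma gen_submod_sub (M' : lmodType R) (h : {linear M -> M'}) (S' : set M') x :
  (forall y, S y -> h y \in gen_submod S') ->
  x \in gen_submod S -> h x \in gen_submod S'.
Proof.
move=> hS; rewrite [x \in _]unfold_in => /asboolP.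
move=> /(_ [set y | h y \in gen_submod S']); apply => //; split=> [|y z hy hz|a y hy] /=.
- by rewrite raddf0 rpred0.
- by rewrite raddfD rpredD.
- by rewrite linearZ rpredZ.
Qed.

End GenSubmod.

Section FlatProjective.
Variables (R : pzRingType) (M : lmodType R).
Hypothesis minR : minimum_condition R.
Hypothesis flatM : flat M.

Notation I := (R * M)%type.
Notation FI := (freeMod R I).
Notation lift := (free_lift (fun p : I => p.2)).

(* The submodule of the free module that is the direct sum of the [R e],
   for [(e, x)] in [A]. *)
Definition dsum (A : set I) : set FI :=
  [set v | (forall p, v p != 0 -> A p) /\ forall p, v p * p.1 = v p].

(** For [P = dsum A] the second clause says that [P / J P -> M / J M] is injective. *)
Definition independent (A : set I) : Prop :=
  (forall p, A p -> local_idempotent p.1 /\ p.1 *: p.2 = p.2) /\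
  forall v, dsum A v -> lift v \in gen_submod (JM [set: M]) -> forall p, Jac (v p).

Lemma independent_bigcup (F : set (set I)) :
  F `<=` independent -> total_on F subset -> independent (\bigcup_(X in F) X).
Proof.
move=> Find Ftot; split=> [p [X FX Xp]|v [vA ve] hv p].
  by have [+ _] := Find X FX; apply.
have [s [us sE _]] := free_lift_fsupp v.
have finite_sub (t : seq I) : (forall q, q \in t -> (\bigcup_(X in F) X) q) ->
    t = [::] \/ exists2 X, F X & forall q, q \in t -> X q.
  elim: t => [|q t IH] ht; [by left|right].
  have [X FX Xq] : (\bigcup_(X in F) X) q by apply: ht; rewrite mem_head.
  have [|t0|[Y FY Yt]] := IH; first by move=> q' qt; apply: ht; rewrite inE qt orbT.
    by exists X => // q'; rewrite t0 inE => /eqP ->.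
  have [XY|YX] := Ftot X Y FX FY.
    by exists Y => // q'; rewrite inE => /orP [/eqP ->|/Yt //]; exact: XY.
  by exists X => // q'; rewrite inE => /orP [/eqP -> //|/Yt]; exact: YX.
have [q|s0|[X FX Xs]] := finite_sub s; first by rewrite -sE; exact: vA.
  have -> : v p = 0 by apply/eqP; apply: contraT; rewrite sE s0.
  exact: Jac0.
have [_ +] := Find X FX; apply=> //; split=> // q; rewrite sE; exact: Xs.
Qed.

Section Maximal.
Variable A : set I.
Hypothesis indA : independent A.
Hypothesis maxA : forall B, A `<` B -> ~ independent B.

Lemma dsum_lift v : dsum A v -> lift v \in gen_submod [set p.2 | p in A].
Proof.
move=> [vA _]; have [s [us sE ->]] := free_lift_fsupp v.
rewrite big_seq; apply: rpred_sum => p ps; apply: rpredZ; apply: sub_gen_submod.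
by exists p => //; apply: vA; rewrite sE.
Qed.

Lemma dsum_delta p : A p -> dsum A (p.1 *: delta R p).
Proof.
have [locA _] := indA; move=> Ap; have [[ee _ _] _] := locA p Ap.
split=> q; rewrite fcoefZ /fcoef /=; case: (eqVneq p q) => [<-//|_].
- by rewrite mulr0 eqxx.
- by rewrite mulr1 ee.
- by rewrite mulr0 mul0r.
Qed.

Lemma submod_dsum : submodule (dsum A).
Proof.
split=> [|u v [uA ue] [vA ve]|a v [vA ve]].
- by split=> p; [rewrite eqxx|rewrite mul0r].
- split=> p; last by rewrite fcoefD mulrDl ue ve.
  rewrite fcoefD; have [u0|/uA //] := eqVneq (u p) 0.
  by rewrite u0 add0r => /vA.
- split=> p; last by rewrite fcoefZ -mulrA ve.
  by rewrite fcoefZ => H; apply: vA; apply: contraNneq H => ->; rewrite mulr0.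
Qed.

Lemma dsumB u v : dsum A u -> dsum A v -> dsum A (u - v).
Proof.
have [_ dD dZ] := submod_dsum; move=> du dv; apply: dD => //.
by rewrite -scaleN1r; exact: dZ.
Qed.

(** Otherwise the quotient by this submodule is nonzero. As the radical kills it, some local
    idempotent [e] acts nontrivially, and a pair [(e, y)] can be added to [A], against
    maximality. *)
Lemma dsum_max x :
  x \in gen_submod ([set p.2 | p in A] `|` JM [set: M]).
Proof.
set S := (X in gen_submod X).
apply: contrapT => nx.
have [||e [q [le eq]]] := @local_idempotent_acts R minR (quotMod S) (proj S x).
- move=> j y jj; rewrite -(proj_repr y) -linearZ; apply: proj_rel.
  by right; exists j, (repr y).
- by rewrite -(raddf0 (proj S)) => /eqP; rewrite projE subr0.
pose y := e *: repr q.
have ny : y \notin gen_submod S.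
  apply/negP => yS; apply: eq; rewrite -(proj_repr q) -linearZ -(raddf0 (proj S)).
  by apply/eqP; rewrite projE subr0.
have [ee ne _] := le.
have ey : e *: y = y by rewrite /y scalerA ee.
pose p0 : I := (e, y).
have nA : ~ A p0.
  by move=> Ap; move/negP: ny; apply; apply: sub_gen_submod; left; exists p0.
apply: (maxA (B := A `|` [set p0])).
  split; first by move=> p; left.
  by move=> /(_ p0) h; apply: nA; apply: h; right.
have [locA jacA] := indA.
split=> [p [/locA //|->]|v [vA ve] hv] //.
pose r := v p0; pose v' : FI := v - r *: delta R p0.
have v'E p : v' p = v p - r * (p0 == p)%:R by [].
have dv' : dsum A v'.
  split=> p; rewrite v'E; last first.
    rewrite mulrBl ve; congr (_ - _); case: (eqVneq p0 p) => [<-|_]; last by rewrite mulr0 mul0r.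
    by rewrite mulr1 /r ve.
  case: (eqVneq p0 p) => [<-|np]; first by rewrite mulr1 subrr eqxx.
  rewrite mulr0 subr0 => /vA [//|/= pp0]; by rewrite pp0 eqxx in np.
have lv' : lift v' = lift v - r *: y by rewrite linearB linearZ /= free_lift_delta.
(* Were [r] not radical, some [s] would give [s * r = e], and [y = s r y] would be generated by [A]
   and [J M]. *)
have jr : Jac r.
  apply: contrapT => nr; have [s hs] := local_idempotent_left le (ve p0) nr.
  move/negP: ny; apply; rewrite -ey -hs -scalerA; apply: rpredZ.
  rewrite (_ : r *: y = lift v - lift v'); last by rewrite lv' opprB addrC subrK.
  have sub T : T `<=` S -> {subset gen_submod T <= gen_submod S}.
    by move=> TS z; apply: (gen_submod_sub (h := idfun)) => w /TS; exact: sub_gen_submod.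
  apply: rpredB.
    by apply: (sub (JM [set: M])) hv => z; right.
  by apply: (sub [set p.2 | p in A]) (dsum_lift dv') => z; left.
have jv' := jacA v' dv'.
move=> p; rewrite (_ : v p = v' p + r * (p0 == p)%:R); last by rewrite v'E subrK.
apply: JacD; last exact: JacMr.
apply: jv'; rewrite lv'; apply: rpredB => //; apply: sub_gen_submod.
by exists r, y.
Qed.

(** By [dsum_max] the quotient by the image is its own multiple by the radical, so Nakayama's lemma
    applies. *)
Lemma dsum_surj x : exists v, dsum A v /\ lift v = x.
Proof.
set T := [set p.2 | p in A].
have xT : x \in gen_submod T.
  rewrite -[x]subr0 -projE raddf0; apply/eqP.
  apply: (@nakayama R minR (quotMod T) [set: quotMod T]) => // q _.
  rewrite -(proj_repr q).
  apply: (gen_submod_sub _ (dsum_max (repr q))) => y [[p Ap <-]|[j [z [jj _ ->]]]].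
    by rewrite -[X in X \in _]/(proj T p.2) proj_rel ?rpred0 //; exists p.
  by apply: sub_gen_submod; exists j, (proj T z); split=> //; rewrite linearZ.
move: xT; rewrite unfold_in => /asboolP /(_ [set x | exists v, dsum A v /\ lift v = x]).
have [d0 dD dZ] := submod_dsum.
apply=> [|_ [p Ap <-]].
  split=> [|_ _ [u [du <-]] [v [dv <-]]|a _ [v [dv <-]]].
  - by exists 0; rewrite raddf0.
  - by exists (u + v); rewrite raddfD; split=> //; exact: dD.
  - by exists (a *: v); rewrite linearZ; split=> //; exact: dZ.
have [locA _] := indA; have [_ px] := locA p Ap.
by exists (p.1 *: delta R p); split; [exact: dsum_delta|rewrite linearZ /= free_lift_delta].
Qed.

Definition dsum_ker : set FI := [set v | dsum A v /\ lift v = 0].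

(* Flatness makes [J (x) M -> R (x) M] injective, hence
   [J (x) M -> P / J K] well defined by lifting along [P -> M], [P = dsum A],
   kills the tensor representing an element of the kernel [K]. *)
Lemma dsum_ker_JM v : dsum_ker v -> v \in gen_submod (JM dsum_ker).
Proof.
move=> [dv lv0]; set JK := JM dsum_ker.
have [_ jacA] := indA; have [locA _] := indA.
have jv : forall p, Jac (v p) by apply: jacA dv _; rewrite lv0 rpred0.
have /choice [sg hsg] := dsum_surj.
have kerB u w : dsum A u -> dsum A w -> lift u = lift w -> dsum_ker (u - w).
  by move=> du dw luw; split; [exact: dsumB|rewrite raddfB /= luw subrr].
(* Preimages under [lift] are unique up to the kernel, so their multiples by a radical element are
   unique modulo [J K]. Hence [g] below is balanced although the choice [sg] need not be
   additive. *)
have JKeq j u w : Jac j -> dsum A u -> dsum A w -> lift u = lift w ->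
    proj JK (j *: u) = proj JK (j *: w).
  move=> jj du dw luw; apply/eqP; rewrite projE -scalerBr; apply: sub_gen_submod.
  by exists j, (u - w); split=> //; exact: kerB.
have [_ dD dZ] := submod_dsum.
pose g (j : jacMod R) (m : M) : zmodule (quotMod JK) :=
  proj JK ((jac_val j : R) *: sg m).
have gDl x x' y : g (x + x') y = g x y + g x' y.
  by rewrite /g -[RHS]projD -scalerDl.
have gDr x y y' : g x (y + y') = g x y + g x y'.
  rewrite /g -[RHS]projD -scalerDr; apply: JKeq; first exact: jac_valP.
  - by case: (hsg (y + y')).
  - by apply: dD; [case: (hsg y)|case: (hsg y')].
  - by rewrite raddfD /= !(proj2 (hsg _)).
have gA x (a : R) y : g ((a : R^c) *: x) y = g x (a *: y).
  transitivity (proj JK ((jac_val x : R) *: (a *: sg y))); first by rewrite scalerA.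
  apply: JKeq; first exact: jac_valP.
  - by apply: dZ; case: (hsg y).
  - by case: (hsg (a *: y)).
  - by rewrite linearZ /= !(proj2 (hsg _)).
have jacP p : (v p : R^c^o) \in @jac R by rewrite unfold_in; apply/asboolP.
pose c p : jacMod R := JacMod (jacP p).
have [s [us sE lE]] := free_lift_fsupp v.
pose incl : {linear jacMod R -> R^c^o} := \val.
(* Over [R] in place of [J] this tensor becomes 1 tensor [lift v], which is 0; flatness reflects the
   vanishing. *)
have t0 : \sum_(p <- s) pure (c p) p.2 = 0 :> tensor M (jacMod R).
  apply: (flat_map0 (f := incl) flatM); first exact: val_inj.
  rewrite raddf_sum (eq_bigr (fun p : I => purer (1 : R^c^o) (v p *: p.2))).
    by rewrite -raddf_sum -lE lv0 raddf0.
  move=> p _; rewrite /= tensor_map_pure /purer -pureA; congr pure.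
  exact: (esym (mulr1 (v p : R^c))).
have gl : tensor_lift g (\sum_(p <- s) pure (c p) p.2) = \sum_(p <- s) g (c p) p.2.
  pose G : {linear tensor M (jacMod R) -> zmodule (quotMod JK)} :=
    HB.pack (tensor_lift g)
      (GRing.isLinear.Build int _ _ *:%R (tensor_lift g) (tensor_lift_linear gDl gDr gA)).
  rewrite -[LHS]/(G _) raddf_sum; apply: eq_bigr => p _; exact: tensor_lift_pure.
have g0 : \sum_(p <- s) g (c p) p.2 = 0.
  rewrite -gl t0; have L := tensor_lift_linear gDl gDr gA.
  by rewrite -[X in tensor_lift _ X](subrr 0) -scaleN1r addrC L scaleN1r addNr.
(* The sum in [g0] is the class of [v]: [v p] equals [v p * p.1], and both [p.1 *: delta R p] and
   [sg p.2] are preimages of [p.2]. *)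
rewrite -[v]subr0 -projE raddf0; apply/eqP; rewrite -g0.
rewrite {1}[v]freeMod_gen lE raddf_sum; apply: eq_big_seq => p ps.
have Ap : A p by case: dv => + _; apply; rewrite sE.
have [_ ve] := dv.
rewrite /g /= -{1}(ve p) -scalerA; apply: JKeq => //.
- exact: dsum_delta.
- by case: (hsg p.2).
- rewrite linearZ /= free_lift_delta (proj2 (hsg _)).
  by have [_ ->] := locA p Ap.
Qed.

Lemma dsum_inj u v : dsum A u -> dsum A v -> lift u = lift v -> u = v.
Proof.
move=> du dv luv; apply/eqP; rewrite -subr_eq0; apply/eqP.
apply: (@nakayama R minR FI dsum_ker dsum_ker_JM).
by split; [exact: dsumB|rewrite raddfB /= luv subrr].
Qed.

(** Injectivity of [lift] on the direct sum makes the chosen preimages depend linearly on the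
    element, so [M] is a direct summand of a free module. *)
Lemma dsum_projective : projective M.
Proof.
have /choice [sg hsg] := dsum_surj.
have [_ dD dZ] := submod_dsum.
apply: (projective_retract (g := fun p : I => p.2) (s := sg)); last by move=> x; case: (hsg x).
move=> a x y; apply: dsum_inj.
- by case: (hsg (a *: x + y)).
- by apply: dD; [apply: dZ; case: (hsg x)|case: (hsg y)].
- by rewrite linearP /= !(proj2 (hsg _)).
Qed.

End Maximal.

Lemma flat_projective : projective M.
Proof.
have [A [indA maxA]] := Zorn_bigcup independent_bigcup.
exact: dsum_projective indA maxA.
Qed.

End FlatProjective.

(** The first conjunct justifies calling the direct sum in (c) a model of the theory. *)
Theorem lemma17 (R : pzRingType) :
  (forall a b : nat -> R, bass_chain a b ->
     model_of_free_theory (freeMod R nat * bassMod b)%type) /\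
  [<-> left_perfect R;
       forall M : lmodType R,
         countably_generated M -> flat M -> model_of_free_theory M ->
         projective M;
       forall a b : nat -> R, bass_chain a b ->
         projective (freeMod R nat * bassMod b)%type].
Proof.
split; first by move=> a b _; exact: bass_model.
tfae.
- by move=> perfR M _ flatM _; exact: perfR.
- move=> cgR a b _; apply: cgR.
  + exact: bass_countably_generated.
  + by apply: flat_prod; [exact: flat_freeMod|exact: flat_bass].
  + exact: bass_model.
- by move=> /bass_minimum_condition minR M flatM; exact: flat_projective.
Qed.
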